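(* Let $(M,\rho,\pi)$ be a quasi-Poisson $G$-manifold (with respect to a chosen $\mathrm{Ad}$-invariant $s\in S^2\mathfrak g$) and let $C\subseteq G$ be a reducing subgroup. Then $$\{f,g\}:=\pi(df,dg),\qquad f,g\in C^\infty(M)^C,$$ is a Poisson bracket on the space $C^\infty(M)^C$ of $C$-invariant functions. In particular, if the action of $C$ on $M$ induces a regular equivalence relation on $M$, then the bivector field $\pi$ descends to define a Poisson structure on $M/C$.
   Context: Let $G$ be a Lie group with Lie algebra $\mathfrak g$ and a chosen $\mathrm{Ad}$-invariant element $s\in S^2\mathfrak g$ (possibly degenerate). Define $s^\sharp:\mathfrak g^*\to\mathfrak g$ by $\beta(s^\sharp\alpha)=s(\alpha,\beta)$ and the invariant element $\phi\in\bigwedge^3\mathfrak g$ by $\phi(\alpha,\beta,\gamma)=\frac14\alpha([s^\sharp\beta,s^\sharp\gamma])$. For an action $\rho$ of $G$ on a manifold $M$, denote also by $\rho:\mathfrak g\to\Gamma(TM)$ the infinitesimal action ($\rho(\xi)_x=\frac{d}{dt}|_{0}\exp(-t\xi)\cdot x$, a Lie algebra homomorphism), extended to a Gerstenhaber algebra morphism $\bigwedge\mathfrak g\to\Gamma(\bigwedge TM)$. A quasi-Poisson $G$-manifold is a triple $(M,\rho,\pi)$ where $\rho$ is an action of $G$ on $M$ and $\pi\in\Gamma(\bigwedge^2TM)$ is a $G$-invariant bivector field with $\frac12[\pi,\pi]=\rho(\phi)$ (Schouten bracket). A Lie subgroup $C\subseteq G$ with Lie algebra $\mathfrak c$ is called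 reducing if $\phi(\alpha,\beta,\gamma)=0$ for all $\alpha,\beta,\gamma\in\operatorname{ann}(\mathfrak c)\subseteq\mathfrak g^*$; equivalently $[s^\sharp\alpha,s^\sharp\beta]\in\mathfrak c$ for all $\alpha,\beta\in\operatorname{ann}(\mathfrak c)$. The action of $C$ induces a regular equivalence relation if the orbit space $M/C$ is a manifold such that $M\to M/C$ is a surjective submersion. *)

(* Defs.v *)
From HB Require Import structures.
From mathcomp Require Import all_boot all_order all_algebra.
From mathcomp Require Import all_classical all_reals all_analysis.

Set Implicit Arguments.
Unset Strict Implicit.
Unset Printing Implicit Defensive.

Import Order.TTheory GRing.Theory Num.Theory.
Import numFieldNormedType.Exports.

Local Open Scope classical_set_scope.
Local Open Scope ring_scope.

(** * Smooth functions on open subsets of R^n *)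

Definition pderiv (R : realType) (n : nat) (i : 'I_n)
    (f : 'rV[R]_n -> R) (x : 'rV[R]_n) : R :=
  derive1 (fun t : R => f (x + t *: delta_mx 0 i)) 0.

Definition iter_pderiv (R : realType) (n : nat) (s : seq 'I_n)
    (f : 'rV[R]_n -> R) : 'rV[R]_n -> R :=
  foldr (@pderiv R n) f s.

(* Meant for open [U]: all iterated partial derivatives exist and are
   continuous at every point of [U]. *)
Definition Cinfty (R : realType) (n : nat) (U : set 'rV[R]_n)
    (f : 'rV[R]_n -> R) : Prop :=
  forall (s : seq 'I_n) (x : 'rV[R]_n), U x ->
    {for x, continuous (iter_pderiv s f)} /\
    forall i : 'I_n,
      derivable (fun t : R => iter_pderiv s f (x + t *: delta_mx 0 i)) 0 1.

(** * Manifolds *)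

(* The dimension is a datum of each chart, so that distinct connected
   components may have distinct dimensions, as may happen for an orbit space.
   [cmap] and [cinv] are total, only their restrictions to [cdom] and to its
   image are meaningful. *)
Record chart (R : realType) (T : topologicalType) := Chart {
  cdim : nat;
  cdom : set T;
  cmap : T -> 'rV[R]_cdim;
  cinv : 'rV[R]_cdim -> T }.
Arguments cdim {R T} c.
Arguments cdom {R T} c.
Arguments cmap {R T} c.
Arguments cinv {R T} c.

Definition is_chart (R : realType) (T : topologicalType) (c : chart R T) :=
  [/\ open (cdom c),
      open (cmap c @` cdom c),
      {in cdom c, cancel (cmap c) (cinv c)},
      {in cdom c, continuous (cmap c)} &
      {in cmap c @` cdom c, continuous (cinv c)}].

Record charted_space (R : realType) := ChartedSpace {
  space :> topologicalType;
  atlas : set (chart R space) }.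
Arguments atlas {R} c.

Definition is_manifold (R : realType) (M : charted_space R) : Prop :=
  [/\ hausdorff_space M, @second_countable M,
      (forall c, atlas M c -> is_chart c),
      (forall x : M, exists2 c, atlas M c & cdom c x) &
      (forall c d, atlas M c -> atlas M d -> forall j : 'I_(cdim d),
         Cinfty (cmap c @` (cdom c `&` cdom d))
                (fun z => cmap d (cinv c z) 0 j))].

Record manifold (R : realType) := Manifold {
  manifold_space :> charted_space R;
  manifoldP : is_manifold manifold_space }.

Definition prod_chart (R : realType) (S T : topologicalType)
    (c : chart R S) (d : chart R T) : chart R (S * T)%type :=
  {| cdim := (cdim c + cdim d)%N;
     cdom := cdom c `*` cdom d;
     cmap := fun z => row_mx (cmap c z.1) (cmap d z.2);
     cinv := fun w => (cinv c (lsubmx w), cinv d (rsubmx w)) |}.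

Definition prod_space (R : realType) (M N : charted_space R) :
    charted_space R :=
  @ChartedSpace R (M * N)%type
    [set e | exists c d, [/\ atlas M c, atlas N d & e = prod_chart c d]].

(* Smooth real functions; [U] is meant to be open. *)
Definition smooth_on (R : realType) (M : charted_space R) (U : set M)
    (f : M -> R) : Prop :=
  forall c, atlas M c ->
    Cinfty (cmap c @` (cdom c `&` U)) (fun z => f (cinv c z)).

Definition smooth_fun (R : realType) (M : charted_space R) (f : M -> R) :=
  smooth_on setT f.

Definition smooth_at (R : realType) (M : charted_space R) (x : M)
    (f : M -> R) : Prop :=
  exists U : set M, [/\ open U, U x & smooth_on U f].

Definition smooth_map (R : realType) (M N : charted_space R) (F : M -> N) :=
  continuous F /\
  forall c d, atlas M c -> atlas N d -> forall j : 'I_(cdim d),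
    Cinfty (cmap c @` (cdom c `&` F @^-1` cdom d))
           (fun z => cmap d (F (cinv c z)) 0 j).

(** * Tangent vectors *)

(* A tangent vector at [x] is a directional derivative in (every) chart around
   [x], acting on the functions that are smooth near [x].  It takes the value
   0 on the other functions, so that it is determined by its action on germs
   of smooth functions. *)
Definition is_tangent (R : realType) (M : charted_space R) (x : M)
    (v : (M -> R) -> R) : Prop :=
  (forall c, atlas M c -> cdom c x ->
     exists a : 'rV[R]_(cdim c), forall f, smooth_at x f ->
       v f = \sum_i a 0 i * pderiv i (fun z => f (cinv c z)) (cmap c x)) /\
  (forall f, ~ smooth_at x f -> v f = 0).

Definition tangent_pred (R : realType) (M : charted_space R) (x : M) :
    {pred ((M -> R) -> R^o)} := fun v => `[< is_tangent x v >].

Record tangent (R : realType) (M : charted_space R) (x : M) := Tangent {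
  tangent_fun :> (M -> R) -> R^o;
  tangentP : tangent_fun \in tangent_pred x }.

HB.instance Definition _ (R : realType) (M : charted_space R) (x : M) :=
  [isSub for @tangent_fun R M x].
HB.instance Definition _ (R : realType) (M : charted_space R) (x : M) :=
  [Choice of tangent x by <:].

Lemma tangent_submod_closed (R : realType) (M : charted_space R) (x : M) :
  submod_closed (tangent_pred x).
Proof.
split=> [|k u v /asboolP[u1 u2] /asboolP[v1 v2]]; apply/asboolP; split=> //.
- move=> c Mc cx; exists 0 => f _; rewrite big1 // => i _.
  by rewrite mxE mul0r.
- move=> c Mc cx; have [a ua] := u1 c Mc cx; have [b vb] := v1 c Mc cx.
  exists (k *: a + b) => f fx.
  rewrite [LHS]/(k * u f + v f) ua// vb//.
  transitivity (\sum_i (k *: a + b) 0 i *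
      pderiv i (fun z => f (cinv c z)) (cmap c x) : R) => //.
  under [RHS]eq_bigr do rewrite !mxE mulrDl -mulrA.
  by rewrite [RHS]big_split -mulr_sumr.
- move=> f fx; rewrite [LHS]/(k * u f + v f) u2// v2// mulr0; exact: addr0.
Qed.

HB.instance Definition _ (R : realType) (M : charted_space R) (x : M) :=
  GRing.isSubmodClosed.Build R ((M -> R) -> R^o) (tangent_pred x)
    (tangent_submod_closed x).
HB.instance Definition _ (R : realType) (M : charted_space R) (x : M) :=
  [SubChoice_isSubLmodule of tangent x by <:].

(* The tangent map of [F] at [x], with values in [T_y N] where [y] is meant to
   be (propositionally) equal to [F x]. *)
Definition push (R : realType) (M N : charted_space R) (F : M -> N)
    (x : M) (y : N) (v : tangent x) : tangent y :=
  xget 0 [set w : tangent y | forall f, smooth_at y f -> w f = v (f \o F)].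

Definition differential (R : realType) (M : charted_space R) (f : M -> R)
    (x : M) : tangent x -> R := fun v => v f.

Definition vector_field (R : realType) (M : charted_space R) :=
  forall x : M, tangent x.

Definition smooth_vector_field_at (R : realType) (M : charted_space R)
    (x : M) (X : vector_field M) : Prop :=
  exists U : set M, [/\ open U, U x &
    forall (V : set M) (f : M -> R), open V -> V `<=` U -> smooth_on V f ->
      smooth_on V (fun y => X y f)].

Definition lie_bracket (R : realType) (M : charted_space R)
    (X Y : vector_field M) : vector_field M := fun x =>
  xget 0 [set Z : tangent x | forall f, smooth_at x f ->
    Z f = X x (fun y => Y y f) - Y x (fun y => X y f)].

(** * Multivectors *)

(* For a finite-dimensional space [V], elements of the symmetric square and of
   the exterior powers of [V] are represented as (skew-)symmetric multilinear
   forms on the dual of [V]; covectors are the functions [V -> R] satisfying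
   [scalar], and only the values of the forms at such functions matter. *)
Definition bilinear_form (R : realType) (V : lmodType R)
    (B : (V -> R) -> (V -> R) -> R) : Prop :=
  forall (a : R) (al be ga : V -> R), scalar al -> scalar be -> scalar ga ->
    B (fun v => a * al v + be v) ga = a * B al ga + B be ga /\
    B ga (fun v => a * al v + be v) = a * B ga al + B ga be.

Definition symmetric2 (R : realType) (V : lmodType R)
    (B : (V -> R) -> (V -> R) -> R) : Prop :=
  bilinear_form B /\
  forall al be : V -> R, scalar al -> scalar be -> B al be = B be al.

Definition bivector (R : realType) (V : lmodType R)
    (B : (V -> R) -> (V -> R) -> R) : Prop :=
  bilinear_form B /\
  forall al be : V -> R, scalar al -> scalar be -> B al be = - B be al.

Definition wedge2 (R : realType) (V : lmodType R) (u v : V)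
    (al be : V -> R) : R := al u * be v - al v * be u.

Definition wedge3 (R : realType) (V : lmodType R) (u v w : V)
    (al be ga : V -> R) : R :=
  al u * wedge2 v w be ga - al v * wedge2 u w be ga + al w * wedge2 u v be ga.

Definition form2_field (R : realType) (M : charted_space R) :=
  forall x : M, (tangent x -> R) -> (tangent x -> R) -> R.

Definition form3_field (R : realType) (M : charted_space R) :=
  forall x : M, (tangent x -> R) -> (tangent x -> R) -> (tangent x -> R) -> R.

Definition bivector_field (R : realType) (M : charted_space R)
    (P : form2_field M) : Prop :=
  (forall x, bivector (P x)) /\
  forall (U : set M) (f g : M -> R), open U -> smooth_on U f ->
    smooth_on U g ->
    smooth_on U (fun x => P x (differential f (x := x))
                              (differential g (x := x))).

(* [P] is the sum of the [X i /\ Y i] near [x]. *)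
Definition wedge_decomposition (R : realType) (M : charted_space R) (n : nat)
    (P : form2_field M) (X Y : 'I_n -> vector_field M) (x : M) : Prop :=
  (forall i, smooth_vector_field_at x (X i) /\
             smooth_vector_field_at x (Y i)) /\
  \forall y \near x, forall al be : tangent y -> R, scalar al -> scalar be ->
    P y al be = \sum_i wedge2 (X i y) (Y i y) al be.

(* [[X /\ Y, Z /\ W] = [X,Z] /\ Y /\ W - [X,W] /\ Y /\ Z
     - [Y,Z] /\ X /\ W + [Y,W] /\ X /\ Z] *)
Definition schouten_wedge (R : realType) (M : charted_space R)
    (X Y Z W : vector_field M) : form3_field M := fun x al be ga =>
    wedge3 (lie_bracket X Z x) (Y x) (W x) al be ga
  - wedge3 (lie_bracket X W x) (Y x) (Z x) al be ga
  - wedge3 (lie_bracket Y Z x) (X x) (W x) al be ga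
  + wedge3 (lie_bracket Y W x) (X x) (Z x) al be ga.

(* [T] is the Schouten bracket of the bivector fields [P] and [Q]: the
   Gerstenhaber bracket extending the Lie bracket of vector fields, computed
   on local decompositions.  Such decompositions exist around every point of
   a manifold (by coordinate vector fields), hence [T] is unique. *)
Definition is_schouten (R : realType) (M : charted_space R)
    (P Q : form2_field M) (T : form3_field M) : Prop :=
  forall (x : M) (m n : nat) (X Y : 'I_m -> vector_field M)
    (Z W : 'I_n -> vector_field M),
    wedge_decomposition P X Y x -> wedge_decomposition Q Z W x ->
    forall al be ga : tangent x -> R, scalar al -> scalar be -> scalar ga ->
      T x al be ga =
        \sum_i \sum_j schouten_wedge (X i) (Y i) (Z j) (W j) al be ga.

(** * Lie groups *)

Record lie_group (R : realType) := LieGroup {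
  lie_manifold :> manifold R;
  lmul : lie_manifold -> lie_manifold -> lie_manifold;
  lone : lie_manifold;
  linv : lie_manifold -> lie_manifold;
  lmulA : associative lmul;
  lmul1 : left_id lone lmul;
  lmulV : left_inverse lone linv lmul;
  lmul_smooth : @smooth_map R (prod_space lie_manifold lie_manifold)
                  lie_manifold (fun z => lmul z.1 z.2);
  linv_smooth : smooth_map linv }.
Arguments lone {R} l.

Notation lie_algebra G := (tangent (lone G)).

Definition left_invariant (R : realType) (G : lie_group R)
    (xi : lie_algebra G) : vector_field G :=
  fun g => push (lmul g) g xi.

Definition lie_algebra_bracket (R : realType) (G : lie_group R)
    (xi eta : lie_algebra G) : lie_algebra G :=
  lie_bracket (left_invariant xi) (left_invariant eta) (lone G).

Definition Ad (R : realType) (G : lie_group R) (g : G) (xi : lie_algebra G) :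
    lie_algebra G :=
  push (fun h => lmul (lmul g h) (linv g)) (lone G) xi.

Definition Ad_invariant (R : realType) (G : lie_group R)
    (s : (lie_algebra G -> R) -> (lie_algebra G -> R) -> R) : Prop :=
  forall (g : G) (al be : lie_algebra G -> R), scalar al -> scalar be ->
    s (al \o Ad g) (be \o Ad g) = s al be.

Definition sharp (R : realType) (V : lmodType R)
    (s : (V -> R) -> (V -> R) -> R) (al : V -> R) : V :=
  xget 0 [set xi : V | forall be : V -> R, scalar be -> be xi = s al be].

Definition phi (R : realType) (G : lie_group R)
    (s : (lie_algebra G -> R) -> (lie_algebra G -> R) -> R)
    (al be ga : lie_algebra G -> R) : R :=
  4^-1 * al (lie_algebra_bracket (sharp s be) (sharp s ga)).

(** * Actions and quasi-Poisson manifolds *)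

Definition lie_action (R : realType) (G : lie_group R) (M : manifold R)
    (act : G -> M -> M) : Prop :=
  [/\ forall x, act (lone G) x = x,
      forall g h x, act (lmul g h) x = act g (act h x) &
      @smooth_map R (prod_space G M) M (fun z => act z.1 z.2)].

(* The derivative at [t = 0] of [exp (- t xi) . x], that is, the image of
   [- xi] under the tangent map at the unit of [g |-> g . x]. *)
Definition infinitesimal_action (R : realType) (G : lie_group R)
    (M : manifold R) (act : G -> M -> M) (xi : lie_algebra G) :
    vector_field M :=
  fun x => push (fun g => act g x) x (- xi).

(* The image of a trivector on the Lie algebra under the extension of
   [infinitesimal_action] to exterior powers. *)
Definition trivector_action (R : realType) (G : lie_group R)
    (M : manifold R) (act : G -> M -> M)
    (t : (lie_algebra G -> R) -> (lie_algebra G -> R) ->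
         (lie_algebra G -> R) -> R) : form3_field M :=
  fun x al be ga =>
    let rho := fun xi => infinitesimal_action act xi x in
    t (al \o rho) (be \o rho) (ga \o rho).

Definition invariant_form2 (R : realType) (G : lie_group R) (M : manifold R)
    (act : G -> M -> M) (P : form2_field M) : Prop :=
  forall (g : G) (x : M) (al be : tangent (act g x) -> R),
    scalar al -> scalar be ->
    P (act g x) al be =
      P x (al \o push (act g) (act g x)) (be \o push (act g) (act g x)).

(* The last condition is [1/2 [P, P] = rho (phi)]. *)
Definition quasi_poisson (R : realType) (G : lie_group R)
    (s : (lie_algebra G -> R) -> (lie_algebra G -> R) -> R)
    (M : manifold R) (act : G -> M -> M) (P : form2_field M) : Prop :=
  [/\ lie_action act, bivector_field P, invariant_form2 act P &
      is_schouten P P (fun x al be ga =>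
        2 * trivector_action act (phi s) (x := x) al be ga)].

(** * Lie subgroups and reduction *)

(* A (not necessarily closed) Lie subgroup, as an injectively immersed Lie
   group. *)
Definition lie_subgroup (R : realType) (G C : lie_group R) (iota : C -> G) :=
  [/\ smooth_map iota,
      forall c d, iota (lmul c d) = lmul (iota c) (iota d),
      injective iota &
      forall c : C, injective (@push R C G iota c (iota c))].

Definition subalgebra (R : realType) (G C : lie_group R) (iota : C -> G) :
    set (lie_algebra G) :=
  range (@push R C G iota (lone C) (lone G)).

Definition annihilator (R : realType) (V : lmodType R) (W : set V) :
    set (V -> R) :=
  [set al | scalar al /\ forall v, W v -> al v = 0].

Definition reducing (R : realType) (G C : lie_group R)
    (s : (lie_algebra G -> R) -> (lie_algebra G -> R) -> R)
    (iota : C -> G) : Prop :=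
  forall al be ga,
    annihilator (subalgebra iota) al -> annihilator (subalgebra iota) be ->
    annihilator (subalgebra iota) ga -> phi s al be ga = 0.

Definition invariant_functions (R : realType) (G C : lie_group R)
    (iota : C -> G) (M : manifold R) (act : G -> M -> M) : set (M -> R) :=
  [set f | smooth_fun f /\ forall (c : C) (x : M), f (act (iota c) x) = f x].

Definition bracket_of (R : realType) (M : charted_space R)
    (P : form2_field M) (f g : M -> R) : M -> R :=
  fun x => P x (differential f (x := x)) (differential g (x := x)).

Definition poisson_bracket (R : realType) (T : Type) (A : set (T -> R))
    (br : (T -> R) -> (T -> R) -> (T -> R)) : Prop :=
  [/\ forall f g, A f -> A g -> A (br f g),
      forall f g, A f -> A g -> br f g = \- br g f,
      forall (a : R) f g h, A f -> A g -> A h ->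
        br (fun x => a * f x + g x) h = (fun x => a * br f h x + br g h x),
      forall f g h, A f -> A g -> A h ->
        br f (fun x => g x * h x) = (fun x => br f g x * h x + g x * br f h x) &
      forall f g h, A f -> A g -> A h -> forall x,
        br f (br g h) x + br g (br h f) x + br h (br f g) x = 0].

Definition surjective_submersion (R : realType) (M N : manifold R)
    (p : M -> N) : Prop :=
  [/\ smooth_map p, forall y, exists x, p x = y &
      forall (x : M) (w : tangent (p x)),
        exists v : tangent x, push p (p x) v = w].

(* [N], with the projection [p], is the orbit space [M / C]. *)
Definition manifold_quotient (R : realType) (G C : lie_group R)
    (iota : C -> G) (M : manifold R) (act : G -> M -> M)
    (N : manifold R) (p : M -> N) : Prop :=
  surjective_submersion p /\
  forall x y : M, p x = p y <-> exists c : C, y = act (iota c) x.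

Definition poisson_structure (R : realType) (M : manifold R)
    (P : form2_field M) : Prop :=
  bivector_field P /\ is_schouten P P (fun _ _ _ _ => 0).

Definition descends (R : realType) (M N : manifold R) (p : M -> N)
    (P : form2_field M) (Q : form2_field N) : Prop :=
  forall (x : M) (al be : tangent (p x) -> R), scalar al -> scalar be ->
    Q (p x) al be = P x (al \o push p (p x)) (be \o push p (p x)).

(* Main.v *)
(* The proof works with functions.  Around each point [P] is a sum of wedges of
   smooth vector fields, and expanding the Schouten bracket [[P, P]] on three
   differentials [df, dg, dh] gives twice the Jacobiator of [f, g, h] for the
   bracket [P df dg].  For a quasi-Poisson manifold this is [2 rho(phi)], so the
   Jacobiator is the value of [phi] at the pullbacks of [df, dg, dh] along the
   infinitesimal action.  If [f, g, h] are constant on the [C]-orbits, then these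
   pullbacks annihilate the Lie algebra of [C], and [phi] vanishes on them.

   On the quotient, the pushforward of [P] is well defined because [P] is
   invariant, and since every covector on [M / C] is the differential of a local
   function, its Jacobi identity is the one of [P] on functions pulled back from
   [M / C].  Its smoothness follows from the fact that a function is smooth as
   soon as its pullback by a submersion is. *)

Require Import Defs.
From HB Require Import structures.
From mathcomp Require Import all_boot all_order all_algebra.
From mathcomp Require Import all_classical all_reals all_analysis.
From mathcomp Require Import ring lra.

Set Implicit Arguments.
Unset Strict Implicit.
Unset Printing Implicit Defensive.

Import Order.TTheory GRing.Theory Num.Theory.
Import numFieldNormedType.Exports.

Local Open Scope classical_set_scope.
Local Open Scope ring_scope.

(** * Differential calculus on R^n *)

(** Three encodings shape the proof. Smoothness means that all iterated partial derivatives exist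
    and are continuous, so differentiability, the chain rule and the symmetry of second derivatives
    are derived from it before charts are used. Tangent maps and Lie brackets are chosen with
    default value 0, so each use rests on the existence of a vector with the prescribed action on
    functions; for tangent maps it comes from the chain rule, for Lie brackets from the symmetry of
    second derivatives. Finally, [is_schouten] ranges over two unrelated decompositions of the same
    bivector field, so the link with the Jacobiator is proved for an arbitrary pair; the factor 2
    appears because each decomposition serves once as the outer one. On the quotient, covectors are
    differentials of functions defined only near a point. The vanishing of the Jacobiator is
    therefore stated at one point [x], for functions smooth near [x] and constant on the orbit of
    [x]. Descent of smoothness uses a slice through [x] on which the submersion is close to the
    identity; there it is inverted by a contraction argument. *)

Lemma derive_line (R : realType) (V : normedModType R) (f : V -> R) x v :
  'D_1 (fun t : R => f (x + t *: v)) 0 = 'D_v f x.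
Proof.
rewrite /derive; set g2 := (X in _ = lim (X @ _)).
rewrite [X in lim (X @ _) = _](_ : _ = g2)//; apply/funext => h; rewrite /g2 /=.
by rewrite addr0 scale0r addr0 [_%:A]mulr1 [x + _]addrC.
Qed.

Lemma pderivE (R : realType) (n : nat) (i : 'I_n) (f : 'rV[R]_n -> R) x :
  pderiv i f x = 'D_(delta_mx 0 i) f x.
Proof. by rewrite /pderiv derive1E derive_line. Qed.

Lemma derivable_line (R : realType) (V : normedModType R) (f : V -> R) x v :
  derivable (fun t : R => f (x + t *: v)) 0 1 <-> derivable f x v.
Proof.
have -> : (fun t : R => f (x + t *: v)) = (fun t : R => f (t *: v + x)).
  by apply/funext => t; rewrite addrC.
by rewrite [X in _ <-> X]derivable1P.
Qed.

Lemma normr_coord (R : realType) (n : nat) (u : 'rV[R]_n) j : `|u 0 j| <= `|u|.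
Proof.
rewrite [leRHS]/Num.norm /= mx_normrE.
exact: (le_bigmax _ (fun ij : 'I_1 * 'I_n => `|u ij.1 ij.2|) (0, j)).
Qed.

Lemma normr_row_le (R : realType) (n : nat) (u : 'rV[R]_n) (e : R) :
  0 <= e -> (forall j, `|u 0 j| <= e) -> `|u| <= e.
Proof.
move=> e0 ue; rewrite [leLHS]/Num.norm /= mx_normrE bigmax_le//= => -[i j] _ /=.
by rewrite ord1.
Qed.

Lemma is_derive_along (R : realType) (V : normedModType R) (f : V -> R) a v (t : R) :
  derivable f (a + t *: v) v ->
  is_derive t 1 (fun t : R => f (a + t *: v)) ('D_v f (a + t *: v)).
Proof.
have eg (h : R) : f ((h *: (1 : R) + t) *: v + a) = f (h *: v + (a + t *: v)).
  by rewrite [_%:A]mulr1 scalerDl -addrA (addrC _ a).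
have E : (fun h : R => h^-1 *: (((fun t : R => f (a + t *: v)) \o shift t) h%:A - f (a + t *: v))) =
   (fun h : R => h^-1 *: ((f \o shift (a + t *: v)) (h *: v) - f (a + t *: v))).
  by apply/funext => h /=; rewrite (addrC a) eg.
move=> df; split.
  by rewrite /derivable E.
by rewrite /derive E.
Qed.

Lemma MVT_along (R : realType) (V : normedModType R) (f : V -> R) a v :
  (forall t : R, 0 <= t <= 1 -> derivable f (a + t *: v) v) ->
  exists2 t : R, 0 <= t <= 1 & f (a + v) - f a = 'D_v f (a + t *: v).
Proof.
move=> df.
have [||t t01] := @MVT_segment R (fun t => f (a + t *: v))
  (fun t => 'D_v f (a + t *: v)) 0 1 ler01.
- by move=> t; rewrite in_itv /= => /andP[t0 t1]; apply/is_derive_along/df; rewrite !ltW.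
- apply: derivable_within_continuous => t; rewrite in_itv /= => t01.
  by have [] := is_derive_along (df _ t01).
rewrite scale0r addr0 scale1r subr0 mulr1 => ft; by exists t; first by move: t01; rewrite in_itv.
Qed.

(** The restriction of [f] to the line is composed with [t |-> h * t]; the chain rule in one
    variable then covers [h = 0] too. *)
Lemma derivable_scale (R : realType) (V : normedModType R) (f : V -> R) a v (h : R) :
  derivable f a v -> derivable f a (h *: v) /\ 'D_(h *: v) f a = h * 'D_v f a.
Proof.
move=> df; pose g (t : R) := f (a + t *: v); pose k (t : R) := h * t.
have dg : derivable g (k 0) 1 by rewrite /k mulr0; apply/derivable_line.
have dk : is_derive (0 : R) (1 : R) k h.
  by apply: is_derive_eq; rewrite /GRing.scale /= mulr1.
have E : g \o k = (fun t : R => f (a + t *: (h *: v))).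
  by apply/funext => t /=; rewrite /g /k scalerA mulrC.
have dgk : derivable (g \o k) 0 1.
  apply/(@derivable1_diffP R R); apply: differentiable_comp.
    by apply/(@derivable1_diffP R R); case: dk.
  exact/(@derivable1_diffP R R).
split; first by apply/derivable_line; rewrite -E.
case: dk => dk dk1; have := @derive1_comp R k g 0 dk dg.
rewrite !derive1E dk1 E derive_line => ->.
by rewrite /k mulr0 /g derive_line mulrC.
Qed.

(** Going from [v] to [u] one coordinate at a time, each step costs at most [eps * |u - v|] by the
    mean value theorem. Balls of the max norm are cubes, so the path stays inside. *)
Lemma lipschitz_coord (R : realType) (n : nat) (f : 'rV[R]_n -> R) x (r eps : R) u v :
  (forall y i, ball x r y -> derivable f y (delta_mx 0 i) /\
     `|pderiv i f y| <= eps) ->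
  ball x r u -> ball x r v -> `|f u - f v| <= n%:R * eps * `|u - v|.
Proof.
move=> fr ur vr.
(* The corners of the path: [w k] has its first [k] coordinates from [u] and the others from [v]. *)
pose w k := \row_(j < n) (if (j < k)%N then u 0 j else v 0 j).
have w0 : w 0%N = v by apply/rowP => j; rewrite mxE.
have wn : w n = u by apply/rowP => j; rewrite mxE ltn_ord.
have wS (k : 'I_n) : w k.+1 = w k + (u 0 k - v 0 k) *: delta_mx 0 k.
  apply/rowP => j; rewrite !mxE eqxx /= ltnS leq_eqVlt.
  have [/val_inj -> | jk] := eqVneq (val j) (val k).
    by rewrite ltnn eqxx mulr1 addrC subrK.
  have -> : (j == k) = false by apply/negP => /eqP jk'; rewrite jk' eqxx in jk.
  by rewrite mulr0 addr0.
have wb (k : 'I_n) (t : R) : 0 <= t <= 1 -> ball x r (w k + t *: ((u 0 k - v 0 k) *: delta_mx 0 k)).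
  move=> /andP[t0 t1]; case: (ur) => r0 ur'; case: (vr) => _ vr'; split=> // i j.
  move: (ur' i j) (vr' i j); rewrite !ord1 /ball /= !mxE eqxx /=.
  have [-> | jk] := eqVneq j k.
    rewrite ltnn mulr1 => xu xv.
    have -> : x 0 k - (v 0 k + t * (u 0 k - v 0 k)) =
        (1 - t) * (x 0 k - v 0 k) + t * (x 0 k - u 0 k) by ring.
    apply: le_lt_trans (ler_normD _ _) _; rewrite !normrM (ger0_norm t0) ger0_norm ?subr_ge0//.
    (* The strict bound comes from the [u] term, which needs [t] nonzero; at [t = 0] it comes from
       [v]. *)
    have [->|t0'] := eqVneq t 0; first by rewrite subr0 mul1r mul0r addr0.
    have t0'' : 0 < t by rewrite lt_neqAle eq_sym t0' t0.
    have := ltr_pM2l t0'' (`|x 0 k - u 0 k|) r; rewrite xu => h1.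
    have h2 : (1 - t) * `|x 0 k - v 0 k| <= (1 - t) * r by rewrite ler_wpM2l ?subr_ge0// ltW.
    by have := ler_ltD h2 h1; rewrite -mulrDl subrK mul1r.
  by rewrite !mulr0 addr0; case: ifP.
have -> : f u - f v = \sum_(k < n) (f (w k.+1) - f (w k)).
  by rewrite -(big_mkord xpredT (fun k => f (w k.+1) - f (w k))) telescope_sumr// wn w0.
apply: le_trans (ler_norm_sum _ _ _) _.
have -> : n%:R * eps * `|u - v| = \sum_(k < n) eps * `|u - v|.
  by rewrite sumr_const card_ord -[RHS]mulr_natl mulrA.
apply: ler_sum => k _; rewrite wS.
have [t t01|t t01 ->] := @MVT_along R _ f (w k) ((u 0 k - v 0 k) *: delta_mx 0 k).
  by apply: (derivable_scale _ _).1; have [] := fr _ k (wb k t t01).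
have [d1 d2] := fr _ k (wb k t t01).
rewrite (derivable_scale _ d1).2 -pderivE normrM mulrC.
apply: ler_pM => //.
by have := normr_coord (u - v) k; rewrite !mxE.
Qed.

Lemma near_all_ord (T : topologicalType) (x : T) (n : nat) (P : 'I_n -> T -> Prop) :
  (forall i, \forall y \near x, P i y) -> \forall y \near x, forall i, P i y.
Proof. by move=> xP; apply: filter_forall. Qed.

Lemma cvg_sum_ord (R : realType) (T : Type) (F : set_system T) (n : nat)
    (f : 'I_n -> T -> R) (a : 'I_n -> R) : Filter F ->
  (forall i, f i x @[x --> F] --> a i) ->
  \sum_i f i x @[x --> F] --> \sum_i a i.
Proof.
move=> FF fa; apply: (@cvg_big R 'I_n +%R 0 xpredT) => //; exact: add_continuous.
Qed.

Lemma diffE_pderiv (R : realType) (n : nat) (f : 'rV[R]_n -> R) x v :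
  differentiable f x -> 'd f x v = \sum_i v 0 i * pderiv i f x.
Proof.
move=> df; rewrite {1}(row_sum_delta v) linear_sum; apply: eq_bigr => i _.
by rewrite linearZ pderivE deriveE.
Qed.

(** Near [x] the partial derivatives of [f] minus the candidate differential [L] are small, so
    [lipschitz_coord] makes this difference little-o. *)
Lemma differentiable_C1 (R : realType) (n : nat) (f : 'rV[R]_n -> R) x :
  (\forall y \near x, forall i, derivable f y (delta_mx 0 i)) ->
  (forall i, {for x, continuous (pderiv i f)}) -> differentiable f x.
Proof.
move=> df cf; pose L (v : 'rV[R]_n) : R := \sum_i v 0 i * pderiv i f x.
have linL : linear (L : 'rV[R]_n -> R^o).
  move=> k u v; rewrite -[RHS]/(k * L u + L v) /L mulr_sumr -big_split.
  apply: eq_bigr => i _.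
  by rewrite !mxE mulrDl mulrA.
pose lL := GRing.isLinear.Build _ _ _ _ _ linL.
pose LL : {linear 'rV[R]_n -> R^o} := HB.pack (L : 'rV[R]_n -> R^o) lL.
have cL : continuous (LL : 'rV[R]_n -> R^o).
  move=> v; apply: (cvg_sum_ord (nbhs_filter v)) => i.
  exact: (@cvgMr_tmp R _ (nbhs v) (nbhs_filter v) (fun w : 'rV[R]_n => w 0 i) _ _
    (@coord_continuous R 1 n 0 i v)).
have dLe y i : is_derive y (delta_mx 0 i) (L : 'rV[R]_n -> R^o) (pderiv i f x).
  have dL := linear_differentiable y cL; split; first exact: diff_derivable.
  rewrite deriveE// (diff_lin y cL) /= /L (bigD1 i)//= mxE !eqxx mul1r big1 ?addr0//.
  by move=> j ji; rewrite mxE eqxx (negbTE ji) mul0r.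
have H : f \o shift x = cst (f x) + (LL : 'rV[R]_n -> R^o) +o_ 0 id.
  apply/eqaddoP => e e0.
  have n0 : 0 < n.+1%:R :> R by [].
  (* [lipschitz_coord] multiplies the bound by [n]; dividing by [n.+1] brings it below [e] and also
     covers [n = 0]. *)
  have : \forall y \near x, forall i, derivable f y (delta_mx 0 i) /\
     `|pderiv i f x - pderiv i f y| <= e / n.+1%:R.
    apply: near_all_ord => i.
    have /cvgrPdist_le/(_ (e / n.+1%:R)) := cf i; rewrite divr_gt0// => /(_ isT).
    by apply: filterS2 df => y dy cy; split.
  move=> /nbhs_ballP[r /= r0 Hr].
  apply/nbhs_ballP; exists r => // v /= v0.
  have vr : ball x r (x + v).
    by move: v0; rewrite -!ball_normE /= sub0r opprD addNKr.
  have := @lipschitz_coord R n (f - (L : 'rV[R]_n -> R)) x r (e / n.+1%:R) (x + v) x.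
  have g1 y i : ball x r y -> derivable (f - (L : 'rV[R]_n -> R)) y (delta_mx 0 i) /\
       `|pderiv i (f - (L : 'rV[R]_n -> R)) y| <= e / n.+1%:R.
    move=> /Hr/(_ i)[d1 d2]; have [l1 l2] := dLe y i.
    split; first exact: derivableB.
    by rewrite pderivE deriveB// l2 -pderivE distrC.
  move=> /(_ g1 vr (ballxx _ r0)).
  have -> : x + v - x = v by rewrite addrAC subrr add0r.
  rewrite !fctE /= (addrC v x).
  have -> : L (x + v) = L x + L v by have := linL 1 x v; rewrite !scale1r.
  rewrite (_ : f (x + v) - _ - _ = f (x + v) - (f x + L v)); last by ring.
  move=> /le_trans; apply; rewrite ler_wpM2r// mulrCA ler_piMr ?ltW//.
  by rewrite ltr_pdivrMr// mul1r ltr_nat.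
by apply/diff_locallyP; rewrite (diff_unique cL H); split.
Qed.

(** Only [f] has to be differentiable: [F] is restricted to the line through [x] along [v], and in
    one variable derivability is differentiability. *)
Lemma derive_chain (R : realType) (V : normedModType R) (n : nat)
    (F : V -> 'rV[R]_n) (f : 'rV[R]_n -> R) x v :
  (forall j, derivable (fun y => F y 0 j) x v) -> differentiable f (F x) ->
  derivable (f \o F) x v /\
  'D_v (f \o F) x = \sum_j 'D_v (fun y => F y 0 j) x * pderiv j f (F x).
Proof.
move=> dF df; pose g (t : R) := F (x + t *: v).
have g0 : g 0 = F x by rewrite /g scale0r addr0.
have dg1 : derivable g 0 1.
  by apply/derivable_mxP => i j; rewrite ord1; apply/(derivable_line (fun y => F y 0 j)).
have dg : differentiable g 0 by apply/derivable1_diffP.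
have df' : differentiable f (g 0) by rewrite g0.
have dfg : differentiable (f \o g) 0 by exact: differentiable_comp.
split; first by apply/derivable_line; exact/(@derivable1_diffP R R).
rewrite -derive_line -[LHS]/('D_1 (f \o g) 0) deriveE// diff_comp//=.
rewrite diffE_pderiv// g0; apply: eq_bigr => j _; congr (_ * _).
have -> : 'd g 0 1 = 'D_1 g 0 by rewrite deriveE.
rewrite derive_mx// mxE.
exact: (derive_line (fun y => F y 0 j)).
Qed.

Lemma continuous_row (R : realType) (T : topologicalType) (n : nat)
    (F : T -> 'rV[R]_n) x :
  (forall j, {for x, continuous (fun y => F y 0 j)}) -> {for x, continuous F}.
Proof.
move=> cF; apply/cvgrPdist_le => e e0.
have : \forall y \near x, forall j, `|F x 0 j - F y 0 j| <= e.
  by apply: near_all_ord => j; have /cvgrPdist_le := cF j; exact.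
apply: filterS => y Fy; apply: normr_row_le; first exact: ltW.
by move=> j; rewrite !mxE.
Qed.

(** A form of smoothness by finite order, suited to induction: the Leibniz and chain rules express
    the derivatives of a product or of a composite through functions of order one less. *)
Fixpoint Ck (R : realType) (n k : nat) (U : set 'rV[R]_n) (f : 'rV[R]_n -> R) : Prop :=
  (forall x, U x -> {for x, continuous f}) /\
  if k is k'.+1 then
    (forall x i, U x -> derivable f x (delta_mx 0 i)) /\
    forall i, Ck k' U (pderiv i f)
  else True.

Lemma Ck_continuous (R : realType) (n k : nat) (U : set 'rV[R]_n) f :
  Ck k U f -> forall x, U x -> {for x, continuous f}.
Proof. by case: k => [|k] []. Qed.

Lemma CkS (R : realType) (n k : nat) (U : set 'rV[R]_n) f : Ck k.+1 U f -> Ck k U f.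
Proof.
elim: k f => [|k IH] f [cf [df pf]]; first by split.
by split=> //; split=> // i; exact/IH/pf.
Qed.

Lemma near_open (T : topologicalType) (U : set T) (P : T -> Prop) x :
  open U -> U x -> (forall y, U y -> P y) -> \forall y \near x, P y.
Proof. by move=> oU Ux UP; apply: filterS UP _; exact: open_nbhs_nbhs. Qed.

Lemma eq_on_pderiv (R : realType) (n : nat) (U : set 'rV[R]_n) f g x i :
  open U -> (forall y, U y -> f y = g y) -> U x -> pderiv i f x = pderiv i g x.
Proof. by move=> oU fg Ux; rewrite !pderivE; apply: near_eq_derive; exact: near_open fg. Qed.

Lemma near_continuous (S T : topologicalType) (f g : S -> T) x :
  (\forall y \near x, f y = g y) -> {for x, continuous f} -> {for x, continuous g}.
Proof.
move=> fg cf; change (g @ x --> g x); rewrite -(nbhs_singleton fg).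
by apply: cvg_trans cf; exact: near_eq_cvg.
Qed.

Lemma Ck_eq (R : realType) (n k : nat) (U : set 'rV[R]_n) f g :
  open U -> (forall y, U y -> f y = g y) -> Ck k U f -> Ck k U g.
Proof.
move=> oU; elim: k f g => [|k IH] f g fg [cf pf].
  by split=> // x Ux; apply: near_continuous (cf x Ux); exact: near_open fg.
split; first by move=> x Ux; apply: near_continuous (cf x Ux); exact: near_open fg.
have [df df'] := pf; split=> [x i Ux|i].
  by apply: near_eq_derivable (df x i Ux); exact: near_open fg.
by apply: IH (df' i) => y Uy; exact: (eq_on_pderiv i oU fg Uy).
Qed.

Lemma Ck_iter_pderiv (R : realType) (n k : nat) (U : set 'rV[R]_n) f s :
  Ck (size s + k) U f -> Ck k U (iter_pderiv s f).
Proof.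
elim: s k => [|i s IH] k //= H.
by have := IH k.+1; rewrite addnS => /(_ H)[_ [_ /(_ i)]].
Qed.

Lemma CinftyP (R : realType) (n : nat) (U : set 'rV[R]_n) f :
  Cinfty U f <-> forall k, Ck k U f.
Proof.
split=> [fU k|fU s x Ux].
  (* The induction is on the order for all iterated derivatives of [f] at once, since its step adds
     an index to the list. *)
  rewrite -[f]/(iter_pderiv [::] f); elim: k [::] => [|k IH] s.
    by split=> // x Ux; have [] := fU s x Ux.
  split; first by move=> x Ux; have [] := fU s x Ux.
  split=> [x i Ux|i]; last exact: (IH (i :: s)).
  by have [_ /(_ i)/derivable_line] := fU s x Ux.
have := @Ck_iter_pderiv R n 1 U f s (fU _) => -[cf [df _]].
by split=> [|i]; [exact: cf|apply/derivable_line; exact: df].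
Qed.

Lemma Ck_differentiable (R : realType) (n k : nat) (U : set 'rV[R]_n) f x :
  open U -> Ck k.+1 U f -> U x -> differentiable f x.
Proof.
move=> oU [_ [df pf]] Ux; apply: differentiable_C1.
  by apply: near_open oU Ux _ => y Uy i; exact: df.
by move=> i; exact: Ck_continuous (pf i) x Ux.
Qed.

Lemma Ck_cst (R : realType) (n k : nat) (U : set 'rV[R]_n) (c : R) : Ck k U (fun=> c).
Proof.
elim: k c => [|k IH] c; split=> //; try by move=> x _; exact: cst_continuous.
split=> [x i _|i]; first exact: derivable_cst.
suff -> : pderiv i (fun=> c : R) = (fun=> 0 : R) by exact: IH.
by apply/funext => x; rewrite pderivE; exact: derive_cst.
Qed.

Lemma pderiv_coord (R : realType) (n : nat) (i j : 'I_n) (x : 'rV[R]_n) :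
  derivable (fun y : 'rV[R]_n => y 0 j) x (delta_mx 0 i) /\
  pderiv i (fun y : 'rV[R]_n => y 0 j) x = (j == i)%:R.
Proof.
have [d1 d2] : is_derive (0 : R) 1 (fun t : R => (x + t *: delta_mx 0 i) 0 j) (j == i)%:R.
  have -> : (fun t : R => (x + t *: delta_mx 0 i) 0 j) = (fun t : R => x 0 j + t * (j == i)%:R).
    by apply/funext => t; rewrite !mxE eqxx.
  have dk : is_derive (0 : R) (1 : R) (fun t : R => t * (j == i)%:R) (j == i)%:R.
    by apply: is_derive_eq; rewrite scaler0 add0r /GRing.scale /= mulr1.
  by apply: is_derive_eq (is_deriveD (is_derive_cst (x 0 j) (0 : R) (1 : R)) dk) _; rewrite add0r.
split; first exact/derivable_line.
by rewrite pderivE -derive_line.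
Qed.

Lemma Ck_coord (R : realType) (n k : nat) (U : set 'rV[R]_n) (j : 'I_n) :
  Ck k U (fun x => x 0 j).
Proof.
case: k => [|k]; split=> //; try by move=> x _; exact: coord_continuous.
split=> [x i _|i]; first by have [] := pderiv_coord i j x.
rewrite (_ : pderiv _ _ = fun=> (j == i)%:R); first exact: Ck_cst.
by apply/funext => x; have [] := pderiv_coord i j x.
Qed.

Lemma CkD (R : realType) (n k : nat) (U : set 'rV[R]_n) f g : open U ->
  Ck k U f -> Ck k U g -> Ck k U (fun x => f x + g x).
Proof.
move=> oU; elim: k f g => [|k IH] f g [cf pf] [cg pg]; split=> //;
  try by move=> x Ux; exact: continuousD (cf x Ux) (cg x Ux).
have [df pf'] := pf; have [dg pg'] := pg.
split=> [x i Ux|i]; first exact: derivableD (df x i Ux) (dg x i Ux).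
apply: Ck_eq oU _ (IH _ _ (pf' i) (pg' i)) => x Ux.
by rewrite !pderivE -deriveD//; [exact: df|exact: dg].
Qed.

Lemma CkM (R : realType) (n k : nat) (U : set 'rV[R]_n) f g : open U ->
  Ck k U f -> Ck k U g -> Ck k U (fun x => f x * g x).
Proof.
move=> oU; elim: k f g => [|k IH] f g Cf Cg.
  by split=> // x Ux; exact: continuousM (Cf.1 x Ux) (Cg.1 x Ux).
have [cf [df pf]] := Cf; have [cg [dg pg]] := Cg.
split; first by move=> x Ux; exact: continuousM (cf x Ux) (cg x Ux).
split=> [x i Ux|i]; first exact: derivableM (df x i Ux) (dg x i Ux).
have Df := CkS Cf; have Dg := CkS Cg.
apply: Ck_eq oU _ (CkD oU (IH _ _ Df (pg i)) (IH _ _ Dg (pf i))) => x Ux.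
by rewrite !pderivE; exact: esym (deriveM (df x i Ux) (dg x i Ux)).
Qed.

Lemma Ck_sum (R : realType) (n k : nat) (U : set 'rV[R]_n) (I : Type) (r : seq I)
    (P : pred I) (f : I -> 'rV[R]_n -> R) : open U ->
  (forall i, Ck k U (f i)) -> Ck k U (fun x => \sum_(i <- r | P i) f i x).
Proof.
move=> oU fU; elim: r => [|i r IH].
  by apply: Ck_eq oU _ (Ck_cst k U 0) => y _; rewrite big_nil.
case: (boolP (P i)) => Pi.
  by apply: Ck_eq oU _ (CkD oU (fU i) IH) => y _; rewrite big_cons Pi.
by apply: Ck_eq oU _ IH => y _; rewrite big_cons (negbTE Pi).
Qed.

Lemma Ck_prod (R : realType) (n k : nat) (U : set 'rV[R]_n) (I : Type) (r : seq I)
    (P : pred I) (f : I -> 'rV[R]_n -> R) : open U ->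
  (forall i, Ck k U (f i)) -> Ck k U (fun x => \prod_(i <- r | P i) f i x).
Proof.
move=> oU fU; elim: r => [|i r IH].
  by apply: Ck_eq oU _ (Ck_cst k U 1) => y _; rewrite big_nil.
case: (boolP (P i)) => Pi.
  by apply: Ck_eq oU _ (CkM oU (fU i) IH) => y _; rewrite big_cons Pi.
by apply: Ck_eq oU _ IH => y _; rewrite big_cons (negbTE Pi).
Qed.

(** The derivative of [f^-1] is [- f^-1 * f^-1] times that of [f], so the induction hypothesis on
    [f^-1] itself supplies the order that is needed. *)
Lemma CkV (R : realType) (n k : nat) (U : set 'rV[R]_n) f : open U ->
  (forall x, U x -> f x != 0) -> Ck k U f -> Ck k U (fun x => (f x)^-1).
Proof.
move=> oU f0; elim: k => [|k IH] Cf.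
  by split=> // x Ux; exact: continuousV (f0 x Ux) (Cf.1 x Ux).
have [cf [df pf]] := Cf.
split; first by move=> x Ux; exact: continuousV (f0 x Ux) (cf x Ux).
split=> [x i Ux|i]; first exact: derivableV (f0 x Ux) (df x i Ux).
have Df := IH (CkS Cf).
apply: Ck_eq oU _ (CkM oU (Ck_cst k U (-1)) (CkM oU (CkM oU Df Df) (pf i))) => x Ux.
rewrite !pderivE [RHS](deriveV (f0 x Ux) (df x i Ux)) /GRing.scale /=.
by rewrite mulN1r mulNr -invfM -expr2.
Qed.

(** By the chain rule a derivative of [f \o F] is a sum of products of derivatives of [F] with
    [pderiv j f \o F], to which the induction hypothesis applies. *)
Lemma Ck_comp (R : realType) (m n k : nat) (U : set 'rV[R]_m) (V : set 'rV[R]_n)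
    (F : 'rV[R]_m -> 'rV[R]_n) (f : 'rV[R]_n -> R) :
  open U -> open V -> (forall x, U x -> V (F x)) ->
  (forall j, Ck k U (fun x => F x 0 j)) -> Ck k V f -> Ck k U (f \o F).
Proof.
move=> oU oV UV; elim: k f => [|k IH] f CF Cf.
  split=> // x Ux; apply: continuous_comp; last exact: Cf.1 _ (UV x Ux).
  by apply: continuous_row => j; exact: (CF j).1.
have [cf [df pf]] := Cf.
have ch x i : U x -> derivable (f \o F) x (delta_mx 0 i) /\
    pderiv i (f \o F) x = \sum_j pderiv i (fun y => F y 0 j) x * pderiv j f (F x).
  move=> Ux; rewrite pderivE; under eq_bigr do rewrite pderivE.
  apply: derive_chain; first by move=> j; exact: (CF j).2.1.
  exact: Ck_differentiable oV Cf (UV x Ux).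
split=> [x Ux|].
  apply: continuous_comp; last exact: cf (UV x Ux).
  by apply: continuous_row => j; exact: (CF j).1.
split=> [x i Ux|i]; first by have [] := ch x i Ux.
apply: (@Ck_eq _ _ _ _ (fun x => \sum_j pderiv i (fun y => F y 0 j) x * (pderiv j f \o F) x)) => //.
  by move=> y Uy; have [_ ->] := ch y i Uy.
apply: (Ck_sum _ _ oU) => j; apply: (CkM oU); first exact: (CF j).2.2.
by apply: IH => [j'|]; [exact/CkS/CF|exact: pf].
Qed.

(** * Symmetry of second derivatives *)

Lemma derive_translate (R : realType) (V : normedModType R) (f : V -> R) y w v :
  derivable f (y + w) v ->
  derivable (fun z => f (z + w)) y v /\ 'D_v (fun z => f (z + w)) y = 'D_v f (y + w).
Proof.
have E : (fun t : R => f (y + t *: v + w)) = (fun t : R => f (y + w + t *: v)).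
  by apply/funext => t; rewrite addrAC.
move=> df; split; first by apply/derivable_line; rewrite E; apply/derivable_line.
by rewrite -derive_line E derive_line.
Qed.

(** The mean value theorem is used twice: along the first side for [f (y + w) - f y], then along the
    second side for [pderiv i f]. *)
Lemma second_difference (R : realType) (n : nat) (U : set 'rV[R]_n) f x i j (h : R) :
  open U -> Ck 2 U f ->
  (forall s t : R, 0 <= s <= 1 -> 0 <= t <= 1 ->
     U (x + s *: (h *: delta_mx 0 i) + t *: (h *: delta_mx 0 j))) ->
  exists s t : R, [/\ 0 <= s <= 1, 0 <= t <= 1 &
    f (x + h *: delta_mx 0 i + h *: delta_mx 0 j) - f (x + h *: delta_mx 0 i)
      - (f (x + h *: delta_mx 0 j) - f x) =
    h * (h * pderiv j (pderiv i f)
      (x + s *: (h *: delta_mx 0 i) + t *: (h *: delta_mx 0 j)))].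
Proof.
set u := h *: delta_mx 0 i; set w := h *: delta_mx 0 j.
move=> oU [_ [df pf]] Ust.
have le01 : ((0 : R) <= 1) && ((1 : R) <= 1) by rewrite ler01 lexx.
have le00 : ((0 : R) <= 0) && ((0 : R) <= 1) by rewrite ler01 lexx.
have D (s : R) : 0 <= s <= 1 -> is_derive (x + s *: u) u (fun y => f (y + w) - f y)
    (h * (pderiv i f (x + s *: u + w) - pderiv i f (x + s *: u))).
  move=> s01; have U1 := Ust s 1 s01 le01; have U0 := Ust s 0 s01 le00.
  rewrite scale1r in U1; rewrite scale0r addr0 in U0.
  have [a1 a2] := derivable_scale h (df _ i U1).
  have [b1 b2] := derivable_scale h (df _ i U0).
  have [c1 c2] := derive_translate a1.
  split; first exact: (derivableB c1 b1).
  by rewrite (deriveB c1 b1) c2 a2 b2 -!pderivE mulrBr.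
have [s s01|s s01] := @MVT_along R _ (fun y => f (y + w) - f y) x u.
  by have [] := D s s01.
have [_ ->] := D s s01 => E.
have [t t01|t t01 E2] := @MVT_along R _ (pderiv i f) (x + s *: u) w.
  exact: (derivable_scale h ((pf i).2.1 _ j (Ust s t s01 t01))).1.
exists s, t; split=> //; rewrite E E2.
by rewrite (derivable_scale h ((pf i).2.1 _ j (Ust s t s01 t01))).2 -pderivE.
Qed.

(** The second difference over a small square is symmetric in [i] and [j], so the two mixed
    derivatives take a common value at two points near [x]; continuity at [x] concludes. *)
Lemma pderivC (R : realType) (n : nat) (U : set 'rV[R]_n) f x i j :
  open U -> Ck 2 U f -> U x -> pderiv i (pderiv j f) x = pderiv j (pderiv i f) x.
Proof.
move=> oU Cf Ux.
suff H (e : R) : 0 < e -> `|pderiv i (pderiv j f) x - pderiv j (pderiv i f) x| <= e.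
  apply/eqP; rewrite -subr_eq0 -normr_le0; apply/ler_addgt0Pl => e e0.
  by rewrite addr0; exact: H.
move=> e0; have e20 : 0 < e / 2 by rewrite divr_gt0.
have tri (a b c d : R) : `|a - b| <= e / 2 -> `|c - d| <= e / 2 -> b = d ->
    `|c - a| <= e.
  move=> ab cd bd; have -> : c - a = (c - d) - (a - b) by rewrite bd opprB addrA subrK.
  by apply: le_trans (ler_normB _ _) _; rewrite [leRHS]splitr lerD.
have near2 k l : \forall y \near x, U y /\
    `|pderiv k (pderiv l f) x - pderiv k (pderiv l f) y| <= e / 2.
  have /cvgrPdist_le/(_ _ e20) := ((Cf.2.2 l).2.2 k).1 x Ux.
  by apply: filterS2 (open_nbhs_nbhs (conj oU Ux)) => y ? ?; split.
have /nbhs_ballP[r /= r0 Hr] : \forall y \near x, (U y /\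
    `|pderiv i (pderiv j f) x - pderiv i (pderiv j f) y| <= e / 2) /\ (U y /\
    `|pderiv j (pderiv i f) x - pderiv j (pderiv i f) y| <= e / 2).
  by apply: filterS2 (near2 i j) (near2 j i) => y ? ?; split.
(* A point of the square is at distance at most [h + h] from [x]. *)
have [h h0 hh] : exists2 h : R, 0 < h & h + h < r by exists (r / 3); lra.
have dn k : `|delta_mx 0 k : 'rV[R]_n| <= 1.
  by apply: normr_row_le => // l; rewrite mxE eqxx; case: (l == k); rewrite ?normr1 ?normr0.
have B k l (s t : R) : 0 <= s <= 1 -> 0 <= t <= 1 ->
    ball x r (x + s *: (h *: delta_mx 0 k) + t *: (h *: delta_mx 0 l)).
  move=> /andP[s0 s1] /andP[t0 t1]; rewrite -ball_normE /= -addrA opprD addNKr normrN.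
  apply: le_lt_trans (hh); apply: le_trans (ler_normD _ _) _.
  have nh : `|h| = h := gtr0_norm h0.
  rewrite !normrZ !nh (ger0_norm s0) (ger0_norm t0).
  apply: lerD.
    apply: le_trans (ler_piMl _ s1) _; first by rewrite mulr_ge0// ltW.
    by rewrite ler_piMr// ltW.
  apply: le_trans (ler_piMl _ t1) _; first by rewrite mulr_ge0// ltW.
  by rewrite ler_piMr// ltW.
have [s [t [s01 t01 E1]]] := @second_difference R n U f x i j h oU Cf
  (fun s t s01 t01 => (Hr _ (B i j s t s01 t01)).1.1).
have [s' [t' [s01' t01' E2]]] := @second_difference R n U f x j i h oU Cf
  (fun s t s01 t01 => (Hr _ (B j i s t s01 t01)).1.1).
have [_ [_ H1]] := Hr _ (B i j s t s01 t01).
have [[_ H2] _] := Hr _ (B j i s' t' s01' t01').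
move: H1 H2; set p := pderiv j _ _; set q := pderiv i _ _.
set p' := pderiv j _ _; set q' := pderiv i _ _ => H1 H2.
(* Both values times [h] squared equal the same second difference, its terms being grouped in two
   ways. *)
have pq : p' = q'.
  apply: (mulfI (lt0r_neq0 h0)); apply: (mulfI (lt0r_neq0 h0)).
  refine (etrans (esym E1) (etrans _ E2)).
  rewrite (addrAC x (h *: delta_mx 0 j)).
  rewrite !opprB.
  rewrite addrACA.
  rewrite [RHS]addrACA.
  by congr (_ + _); rewrite addrC.
exact: tri H1 H2 pq.
Qed.

(** * Calculus of smooth functions on open sets *)

Lemma Cinfty_eq (R : realType) (n : nat) (U : set 'rV[R]_n) f g :
  open U -> (forall y, U y -> f y = g y) -> Cinfty U f -> Cinfty U g.
Proof. by move=> oU fg /CinftyP Cf; apply/CinftyP => k; exact: Ck_eq fg (Cf k). Qed.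

Lemma Cinfty_sub (R : realType) (n : nat) (U V : set 'rV[R]_n) f :
  V `<=` U -> Cinfty U f -> Cinfty V f.
Proof. by move=> VU Cf s x /VU; exact: Cf. Qed.

Lemma Cinfty_cst (R : realType) (n : nat) (U : set 'rV[R]_n) (c : R) : Cinfty U (fun=> c).
Proof. by apply/CinftyP => k; exact: Ck_cst. Qed.

Lemma Cinfty_coord (R : realType) (n : nat) (U : set 'rV[R]_n) j : Cinfty U (fun x => x 0 j).
Proof. by apply/CinftyP => k; exact: Ck_coord. Qed.

Lemma CinftyD (R : realType) (n : nat) (U : set 'rV[R]_n) f g : open U ->
  Cinfty U f -> Cinfty U g -> Cinfty U (fun x => f x + g x).
Proof. by move=> oU /CinftyP Cf /CinftyP Cg; apply/CinftyP => k; exact: CkD. Qed.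

Lemma CinftyM (R : realType) (n : nat) (U : set 'rV[R]_n) f g : open U ->
  Cinfty U f -> Cinfty U g -> Cinfty U (fun x => f x * g x).
Proof. by move=> oU /CinftyP Cf /CinftyP Cg; apply/CinftyP => k; exact: CkM. Qed.

Lemma Cinfty_sum (R : realType) (n : nat) (U : set 'rV[R]_n) (I : Type) (r : seq I)
    (P : pred I) (f : I -> 'rV[R]_n -> R) : open U ->
  (forall i, Cinfty U (f i)) -> Cinfty U (fun x => \sum_(i <- r | P i) f i x).
Proof.
by move=> oU Cf; apply/CinftyP => k; apply: (Ck_sum _ _ oU) => i; move/CinftyP: (Cf i).
Qed.

Lemma Cinfty_comp (R : realType) (m n : nat) (U : set 'rV[R]_m) (V : set 'rV[R]_n)
    (F : 'rV[R]_m -> 'rV[R]_n) (f : 'rV[R]_n -> R) :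
  open U -> open V -> (forall x, U x -> V (F x)) ->
  (forall j, Cinfty U (fun x => F x 0 j)) -> Cinfty V f -> Cinfty U (f \o F).
Proof.
move=> oU oV UV CF /CinftyP Cf; apply/CinftyP => k.
by apply: Ck_comp oU oV UV _ (Cf k) => j; move/CinftyP: (CF j).
Qed.

Lemma Cinfty_pderiv (R : realType) (n : nat) (U : set 'rV[R]_n) f i :
  Cinfty U f -> Cinfty U (pderiv i f).
Proof. by move=> /CinftyP Cf; apply/CinftyP => k; have [_ [_]] := Cf k.+1; exact. Qed.

Lemma Cinfty_continuous (R : realType) (n : nat) (U : set 'rV[R]_n) f x :
  Cinfty U f -> U x -> {for x, continuous f}.
Proof. by move=> /CinftyP/(_ 0%N)[cf _]; exact: cf. Qed.

Lemma Cinfty_differentiable (R : realType) (n : nat) (U : set 'rV[R]_n) f x :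
  open U -> Cinfty U f -> U x -> differentiable f x.
Proof. by move=> oU /CinftyP/(_ 1%N) Cf; exact: Ck_differentiable Cf. Qed.

Lemma Cinfty_derivable (R : realType) (n : nat) (U : set 'rV[R]_n) f x i :
  Cinfty U f -> U x -> derivable f x (delta_mx 0 i).
Proof. by move=> /CinftyP/(_ 1%N)[_ [df _]]; exact: df. Qed.

Lemma Cinfty_near (R : realType) (n : nat) (U : set 'rV[R]_n) f :
  (forall x, U x -> exists V, V x /\ Cinfty V f) -> Cinfty U f.
Proof. by move=> Uf s x /Uf[V [Vx Cf]]; exact: Cf. Qed.

Lemma pderiv_comp (R : realType) (m n : nat) (F : 'rV[R]_m -> 'rV[R]_n)
    (f : 'rV[R]_n -> R) x i :
  (forall j, derivable (fun y => F y 0 j) x (delta_mx 0 i)) ->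
  differentiable f (F x) ->
  pderiv i (f \o F) x = \sum_j pderiv i (fun y => F y 0 j) x * pderiv j f (F x).
Proof.
move=> dF df; rewrite pderivE; under eq_bigr do rewrite pderivE.
exact: (derive_chain dF df).2.
Qed.

(** * Local inverses and submersions *)

Lemma Ck_det (R : realType) (n k m : nat) (U : set 'rV[R]_n) (A : 'rV[R]_n -> 'M[R]_m) :
  open U -> (forall i j, Ck k U (fun x => A x i j)) -> Ck k U (fun x => \det (A x)).
Proof.
move=> oU CA; rewrite /determinant; apply: (Ck_sum _ _ oU) => s.
apply: (CkM oU); first exact: Ck_cst.
by apply: (Ck_prod _ _ oU) => i; exact: CA.
Qed.

(** By Cramer's rule the entries of the inverse are cofactors divided by the determinant. *)
Lemma Ck_invmx (R : realType) (n k m : nat) (U : set 'rV[R]_n) (A : 'rV[R]_n -> 'M[R]_m) i j :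
  open U -> (forall x, U x -> \det (A x) != 0) ->
  (forall i j, Ck k U (fun x => A x i j)) -> Ck k U (fun x => invmx (A x) i j).
Proof.
move=> oU A0 CA.
have CC : Ck k U (fun x => cofactor (A x) j i).
  rewrite /cofactor; apply: (CkM oU); first exact: Ck_cst.
  apply: (Ck_det oU) => i' j'.
  by apply: Ck_eq oU _ (CA (lift j i') (lift i j')) => x _; rewrite !mxE.
apply: Ck_eq oU _ (CkM oU (CkV oU A0 (Ck_det oU CA)) CC) => x Ux.
by rewrite /invmx unitmxE unitfE (A0 x Ux) !mxE.
Qed.

Lemma continuous_dist (R : realType) (V : normedModType R) (T : topologicalType)
    (f g : T -> V) x : {for x, continuous f} -> {for x, continuous g} ->
  {for x, continuous (fun y => `|f y - g y|)}.
Proof.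
move=> cf cg; apply: (@continuous_comp _ _ _ (f - g) (@Num.norm R V)).
  exact: continuousB.
exact: norm_continuous.
Qed.

Lemma compact_closed_ball_rV (R : realType) (n : nat) (x : 'rV[R]_n) (r : R) :
  compact [set u | `|u - x| <= r].
Proof.
apply: bounded_closed_compact.
  exists (r + `|x|); split; first exact: num_real.
  move=> M rM u /= ur; rewrite -(subrK x u) (le_trans (ler_normD _ _))//.
  by rewrite (le_trans _ (ltW rM))// lerD2r.
rewrite (_ : [set u | _] = (fun u : 'rV[R]_n => `|u - x|) @^-1` [set t | t <= r])//.
apply: closed_comp; last exact: closed_le.
by move=> u _; apply: (@continuous_dist R 'rV[R]_n _ id (cst x));
  [exact: cvg_id|exact: cst_continuous].
Qed.

(* The map [u |-> u - (q u - y)] contracts the closed ball, which is compact: a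
   minimizer of [|q u - y|] is a fixed point. *)
Lemma perturbed_identity_onto (R : realType) (n : nat) (q : 'rV[R]_n -> 'rV[R]_n) u0 (r : R) :
  0 < r ->
  (forall u, `|u - u0| <= r -> {for u, continuous q}) ->
  (forall u v, `|u - u0| <= r -> `|v - u0| <= r ->
     `|q u - u - (q v - v)| <= 2^-1 * `|u - v|) ->
  forall y, `|y - q u0| < r / 2 -> exists2 u, `|u - u0| < r & q u = y.
Proof.
move=> r0 cq lq y yq; set B := [set u | `|u - u0| <= r].
have u0B : B u0 by rewrite /B /= subrr normr0 ltW.
pose P u := u - (q u - y).
have Pr u : B u -> `|P u - u0| < r.
  move=> Bu; have -> : P u - u0 = (y - q u0) - (q u - u - (q u0 - u0)).
    by rewrite /P !opprB !addrA; apply/rowP => j; rewrite !mxE; ring.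
  apply: le_lt_trans (ler_normB _ _) _.
  have := lq u u0 Bu u0B; have : `|u - u0| <= r by [].
  by move: yq; move: `|y - q u0| `|u - u0| `|_ - _| => a b c; lra.
have [] := @EVT_min_rV R n (fun u => `|q u - y|) B.
- by exists u0.
- exact: compact_closed_ball_rV.
- apply: continuous_in_subspaceT => u; rewrite inE => Bu.
  by apply: continuous_dist; [exact: cq|exact: cst_continuous].
move=> u; rewrite inE => Bu minu.
have PB : B (P u) by exact/ltW/Pr.
have := minu (P u); rewrite inE => /(_ PB) le1.
(* Hence [|q (P u) - y|] is at most half of [|q u - y|], which is minimal at [u]; this forces the
   minimum to be 0. *)
have E1 : q (P u) - y = q (P u) - P u - (q u - u).
  by rewrite /P; apply/rowP => j; rewrite !mxE; ring.
have E2 : P u - u = - (q u - y).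
  by rewrite /P addrAC subrr add0r.
have := lq _ _ PB Bu; rewrite -E1 E2 normrN => le2.
have qy : q u - y = 0.
  apply/eqP; rewrite -normr_le0; move: le1 le2.
  by move: `|_ - _| `|_ - _| => a b; lra.
exists u; last by apply/eqP; rewrite -subr_eq0 qy.
by have := Pr u Bu; rewrite /P qy subr0.
Qed.

Lemma lipschitz_continuous_at (R : realType) (V W : normedModType R) (U : set V)
    (f : V -> W) y (k : R) : open U -> U y ->
  (forall z, U z -> `|f y - f z| <= k * `|y - z|) -> {for y, continuous f}.
Proof.
move=> oU Uy lf; apply/cvgrPdist_le => e e0.
have k0 : 0 < `|k| + 1 by rewrite ltr_wpDl.
have /nbhs_ballP[r /= r0 Hr] := open_nbhs_nbhs (conj oU Uy).
have d0 : 0 < Num.min r (e / (`|k| + 1)) by rewrite lt_min r0 divr_gt0.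
apply/nbhs_ballP; exists (Num.min r (e / (`|k| + 1))) => // z yz.
have Uz : U z by apply: Hr; apply: le_ball yz; rewrite ge_min lexx.
apply: le_trans (lf z Uz) _.
move: yz; rewrite -ball_normE /= lt_min => /andP[_].
rewrite ltr_pdivlMr// mulrC => /ltW; apply: le_trans.
by rewrite ler_wpM2r// (le_trans (ler_norm k))// lerDl.
Qed.

Lemma near_line (R : realType) (V : normedModType R) (U : set V) y v :
  open U -> U y -> \forall h \near (0 : R), U (h *: v + y).
Proof.
move=> oU Uy.
have c : {for (0 : R), continuous (fun h : R => h *: v + y)}.
  by apply: continuousD; [exact: scalel_continuous|exact: cst_continuous].
apply: (c U); rewrite /= scale0r add0r; exact: open_nbhs_nbhs (conj oU Uy).
Qed.

(** With row vectors the Jacobian matrix [J] acts on the right. If [w] is the increment of [sg] for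
    the step [h] along the [i]-th basis vector, then [h *: delta_mx 0 i] is [w *m J] up to little-o
    of [|w|], and the Lipschitz bound turns this into little-o of [|h|]. Multiplying by [A] on the
    right isolates [w]. *)
Lemma is_derive_local_inverse (R : realType) (n : nat) (q sg : 'rV[R]_n -> 'rV[R]_n)
    (V : set 'rV[R]_n) (A : 'M[R]_n) y i j :
  open V -> V y -> (forall y, V y -> q (sg y) = y) ->
  (forall z, V z -> `|sg y - sg z| <= 2 * `|y - z|) ->
  (forall l, differentiable (fun u => q u 0 l) (sg y)) ->
  \matrix_(i, j) pderiv i (fun u => q u 0 j) (sg y) *m A = 1%:M ->
  is_derive y (delta_mx 0 i) (fun y => sg y 0 j) (A i j).
Proof.
move=> oV Vy qsg lsg dq; set u := sg y; set J := \matrix_(_, _) _ => JA.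
suff cv : h^-1 *: (sg (h *: delta_mx 0 i + y) 0 j - sg y 0 j) @[h --> (0 : R)^'] --> A i j.
  by split; [apply/cvg_ex; exists (A i j)|apply: cvg_lim cv].
apply/cvgrPdist_le => e e0.
have [K K0 KE] : exists2 K : R, 0 <= K & K = \sum_l `|A l j|.
  by exists (\sum_l `|A l j|) => //; apply: sumr_ge0.
(* The 2 is the Lipschitz constant of [sg], and [K] is the sum of column [j] of [A] in absolute
   value; [K + 1] avoids a zero denominator. *)
have [eta eta0 etaK] : exists2 eta : R, 0 < eta & 2 * eta * K <= e.
  have K1 : 0 < 2 * (K + 1) by rewrite mulr_gt0// ltr_wpDl.
  exists (e / (2 * (K + 1))); first by rewrite divr_gt0.
  rewrite mulrAC mulrA ler_pdivrMr// [leRHS]mulrC ler_wpM2r ?ltW//.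
  by rewrite ltr_pM2l// ltrDl.
have : \forall w \near (0 : 'rV[R]_n), forall l,
    `|q (w + u) 0 l - q u 0 l - (w *m J) 0 l| <= eta * `|w|.
  apply: near_all_ord => l.
  have /diff_locallyP[_ /eqaddoP/(_ eta eta0)] := dq l.
  apply: filterS => w; rewrite /= !fctE /= diffE_pderiv//.
  rewrite opprD addrA.
  rewrite (_ : (w *m J) 0 l = \sum_k w 0 k * pderiv k (fun u => q u 0 l) u)//.
  by rewrite mxE; apply: eq_bigr => k _; rewrite mxE.
move=> /nbhs_ballP[rho /= rho0 Hq].
have Hh : \forall h \near (0 : R), 2 * `|h| < rho.
  apply/nbhs_ballP; exists (rho / 2) => [|h] /=; first by rewrite divr_gt0.
  by rewrite -ball_normE /= sub0r normrN ltr_pdivlMr// mulrC.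
rewrite /dnbhs near_withinE.
apply: filterS2 (near_line (delta_mx 0 i) oV Vy) Hh => h Vh hrho h0.
pose w := sg (h *: delta_mx 0 i + y) - u.
have wh : `|w| <= 2 * `|h|.
  rewrite /w distrC; apply: le_trans (lsg _ Vh) _.
  rewrite opprD addrCA subrr addr0 normrN normrZ ler_wpM2l// ler_piMr//.
  by apply: normr_row_le => // l; rewrite mxE eqxx; case: (l == i); rewrite ?normr1 ?normr0.
have wrho : ball (0 : 'rV[R]_n) rho w.
  by rewrite -ball_normE /= sub0r normrN (le_lt_trans wh).
(* Because [J *m A = 1], the error of the difference quotient is the first-order remainder of [q]
   transported by [A]. *)
have E : h * A i j - w 0 j = \sum_l (h *: delta_mx 0 i - w *m J) 0 l * A l j.
  have : (h *: delta_mx 0 i - w *m J) *m A = h *: row i A - w.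
    by rewrite mulmxBl -mulmxA JA mulmx1 -scalemxAl -rowE.
  move=> /matrixP/(_ 0 j); rewrite !mxE => <-.
  by [].
have le1 : `|h * A i j - w 0 j| <= 2 * eta * `|h| * K.
  rewrite E; apply: le_trans (ler_norm_sum _ _ _) _.
  rewrite KE mulr_sumr; apply: ler_sum => l _; rewrite normrM ler_wpM2r//.
  have := Hq w wrho l; rewrite /w subrK !qsg// -/w => Hl.
  have -> : (h *: delta_mx 0 i - w *m J) 0 l =
      (h *: delta_mx 0 i + y) 0 l - y 0 l - (w *m J) 0 l.
    by rewrite !mxE addrK.
  apply: le_trans Hl _.
  by rewrite (mulrC 2) -mulrA ler_wpM2l// ltW.
have -> : A i j - h^-1 *: (sg (h *: delta_mx 0 i + y) 0 j - sg y 0 j) =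
    h^-1 * (h * A i j - w 0 j).
  by rewrite mulrBr mulKf// /w !mxE.
rewrite normrM normfV ler_pdivrMl ?normr_gt0//.
by apply: le_trans le1 _; rewrite mulrAC [leRHS]mulrC ler_wpM2r.
Qed.

(* A partial derivative of [G \o sg] is again a smooth function composed with
   [sg], which allows an induction on the order of differentiability. *)
Lemma Cinfty_local_inverse (R : realType) (n : nat) (q sg : 'rV[R]_n -> 'rV[R]_n)
    (V W : set 'rV[R]_n) :
  open V -> open W -> (forall y, V y -> W (sg y)) -> (forall y, V y -> q (sg y) = y) ->
  (forall y z, V y -> V z -> `|sg y - sg z| <= 2 * `|y - z|) ->
  (forall j, Cinfty W (fun u => q u 0 j)) ->
  (forall u, W u -> \det (\matrix_(i, j) pderiv i (fun u => q u 0 j) u) != 0) ->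
  forall G, Cinfty W G -> Cinfty V (G \o sg).
Proof.
move=> oV oW VW qsg lsg Cq detq.
pose J u := \matrix_(i, j) pderiv i (fun u => q u 0 j) u.
have csg y : V y -> {for y, continuous sg}.
  by move=> Vy; apply: (lipschitz_continuous_at oV Vy) => z; exact: lsg.
have dsg y i j : V y ->
    is_derive y (delta_mx 0 i) (fun y => sg y 0 j) (invmx (J (sg y)) i j).
  move=> Vy; apply: (@is_derive_local_inverse R n q sg V (invmx (J (sg y))) y i j oV Vy qsg).
  - by move=> z; exact: lsg.
  - by move=> l; exact: Cinfty_differentiable oW (Cq l) (VW y Vy).
  - by rewrite mulmxV// unitmxE unitfE detq//; exact: VW.
move=> G /CinftyP CG; apply/CinftyP => k; elim: k G CG => [|k IH] G CG.
  split=> // y Vy; apply: continuous_comp; first exact: csg.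
  exact: (CG 0%N).1 _ (VW y Vy).
have ch y i : V y -> derivable (G \o sg) y (delta_mx 0 i) /\
    pderiv i (G \o sg) y = \sum_j invmx (J (sg y)) i j * pderiv j G (sg y).
  move=> Vy; have dG := Ck_differentiable oW (CG 1%N) (VW y Vy).
  have ds j : derivable (fun y => sg y 0 j) y (delta_mx 0 i) by have [] := dsg y i j Vy.
  split; first exact: (derive_chain ds dG).1.
  rewrite (pderiv_comp ds dG); apply: eq_bigr => j _; rewrite pderivE.
  by have [_ ->] := dsg y i j Vy.
split; first by move=> y Vy; apply: (continuous_comp (csg y Vy)); exact: (CG 0%N).1 _ (VW y Vy).
split=> [y i Vy|i]; first by have [] := ch y i Vy.
pose N i u := \sum_j invmx (J u) i j * pderiv j G u.
apply: (@Ck_eq _ _ _ _ (N i \o sg)) => //; first by move=> y Vy; have [_ ->] := ch y i Vy.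
apply: IH => k'; apply: (Ck_sum _ _ oW) => j; apply: (CkM oW); last exact: (CG k'.+1).2.2.
apply: (Ck_invmx i j oW detq) => i' j'.
have -> : (fun u => (\matrix_(i, j) pderiv i (fun u => q u 0 j) u) i' j') =
    pderiv i' (fun u => q u 0 j') by apply/funext => u; rewrite mxE.
by have /CinftyP := Cinfty_pderiv i' (Cq j').
Qed.

(** Nothing is known about [H] itself. Since the Jacobian matrix of [q] at [u0] is 1, [q] minus the
    identity is Lipschitz with constant 1/2 near [u0], so [q] has a local section [sg], and [H] is
    [(H \o q) \o sg] near [q u0]. *)
Lemma Cinfty_descend_square (R : realType) (n : nat) (O : set 'rV[R]_n)
    (q : 'rV[R]_n -> 'rV[R]_n) (H : 'rV[R]_n -> R) u0 :
  open O -> O u0 -> (forall j, Cinfty O (fun u => q u 0 j)) ->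
  (forall i j, pderiv i (fun u => q u 0 j) u0 = (i == j)%:R) ->
  Cinfty O (H \o q) -> exists V, [/\ open V, V (q u0) & Cinfty V H].
Proof.
move=> oO Ou0 Cq q1 CH.
pose J u := \matrix_(i, j) pderiv i (fun u => q u 0 j) u.
(* [lipschitz_coord] multiplies by [n], so this gives the constant 1/2, also for [n = 0]. *)
pose eps : R := 2^-1 / n.+1%:R.
have eps0 : 0 < eps by rewrite divr_gt0.
have : \forall u \near u0, (O u /\ \det (J u) != 0) /\
    forall i j, `|pderiv i (fun u => q u 0 j) u0 - pderiv i (fun u => q u 0 j) u| <= eps.
  apply: filterS2; [by move=> u a b; split; [exact: a|exact: b]| |].
    apply: filterS2; [by move=> u a b; split; [exact: a|exact: b]| |].
      exact: open_nbhs_nbhs (conj oO Ou0).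
    have cdet : {for u0, continuous (fun u => \det (J u))}.
      have /Ck_continuous : Ck 0 O (fun u => \det (J u)); last exact.
      apply: Ck_det => // i j.
      have -> : (fun u => J u i j) = pderiv i (fun u => q u 0 j) by apply/funext => u; rewrite mxE.
      by have /CinftyP := Cinfty_pderiv i (Cq j).
    have J1 : J u0 = 1%:M by apply/matrixP => i j; rewrite !mxE q1.
    have /cvgrPdist_lt/(_ 1 ltr01) := cdet; rewrite J1 det1; apply: filterS => u.
    by apply: contraTneq => ->; rewrite subr0 normr1 ltxx.
  apply: (@near_all_ord 'rV[R]_n u0 n (fun i u => forall j,
    `|pderiv i (fun u => q u 0 j) u0 - pderiv i (fun u => q u 0 j) u| <= eps)) => i.
  apply: (@near_all_ord 'rV[R]_n u0 n (fun j u =>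
    `|pderiv i (fun u => q u 0 j) u0 - pderiv i (fun u => q u 0 j) u| <= eps)) => j.
  have /cvgrPdist_le := Cinfty_continuous (Cinfty_pderiv i (Cq j)) Ou0; exact.
move=> /nbhs_ballP[r /= r0 Hr]; set W := ball u0 r in Hr.
have oW : open W by exact: ball_open.
have WO : W `<=` O by move=> u /Hr[[]].
have CqW j : Cinfty W (fun u => q u 0 j) by exact: Cinfty_sub WO (Cq j).
have lq u v : W u -> W v -> `|q u - u - (q v - v)| <= 2^-1 * `|u - v|.
  move=> Wu Wv; apply: normr_row_le => [|j]; first by rewrite mulr_ge0// invr_ge0.
  have gd y i : W y -> derivable (fun y => q y 0 j - y 0 j) y (delta_mx 0 i) /\
      `|pderiv i (fun y => q y 0 j - y 0 j) y| <= eps.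
    move=> Wy; have d1 := Cinfty_derivable (i := i) (CqW j) Wy.
    have [d2 E2] := pderiv_coord i j y; have [_ /(_ i j)] := Hr y Wy.
    split; first exact: derivableB d1 d2.
    by rewrite pderivE (deriveB d1 d2) -!pderivE E2 eq_sym -q1 distrC.
  have := lipschitz_coord gd Wu Wv; rewrite !mxE => /le_trans; apply.
  rewrite ler_wpM2r// /eps mulrCA ler_piMr ?invr_ge0//.
  by rewrite ler_pdivrMr// mul1r ler_nat.
(* The triangle inequality absorbs half of [|u - v|], so [q] is injective on [W] with an inverse of
   Lipschitz constant 2. *)
have lq2 u v : W u -> W v -> `|u - v| <= 2 * `|q u - q v|.
  move=> Wu Wv; have := lq u v Wu Wv.
  have -> : q u - u - (q v - v) = (q u - q v) - (u - v).
    by rewrite !opprB addrACA [RHS]addrACA; congr (_ + _); rewrite addrC.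
  have := ler_distD (q u - q v) (u - v) 0; rewrite !subr0 (distrC (u - v)).
  by move: `|u - v| `|q u - q v| `|_ - _| => a b c; lra.
(* The first halving puts a closed ball inside the open ball [W]; the second is the loss in
   [perturbed_identity_onto]. *)
pose V := ball (q u0) (r / 2 / 2).
have WB u : `|u - u0| <= r / 2 -> W u.
  move=> ur; rewrite /W -ball_normE /= distrC (le_lt_trans ur)//.
  by rewrite ltr_pdivrMr// ltr_pMr// ltr1n.
have onto y : V y -> exists u, W u /\ q u = y.
  rewrite /V -ball_normE /= distrC => yV.
  have [|||u ur quy] := @perturbed_identity_onto R n q u0 (r / 2) _ _ _ y yV.
  - by rewrite divr_gt0.
  - move=> u /WB Wu; apply: continuous_row => j; exact: Cinfty_continuous (CqW j) Wu.
  - by move=> u v /WB Wu /WB Wv; exact: lq.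
  by exists u; split=> //; apply/WB/ltW.
pose sg y := xget u0 [set u | W u /\ q u = y].
have sgP y : V y -> W (sg y) /\ q (sg y) = y.
  by move=> /onto[u Wu]; rewrite /sg; case: xgetP => [v -> []//|/(_ u)[]].
exists V; split.
- exact: ball_open.
- by apply: ballxx; rewrite !divr_gt0.
apply: (@Cinfty_eq R n V ((H \o q) \o sg)).
- exact: ball_open.
- by move=> y /sgP[_ /= ->].
apply: (@Cinfty_local_inverse R n q sg V W) => //.
- exact: ball_open.
- by move=> y /sgP[].
- by move=> y /sgP[].
- move=> y z /sgP[Wy qy] /sgP[Wz qz]; have := lq2 _ _ Wy Wz.
  by rewrite qy qz.
- by move=> u /Hr[[]].
- exact: Cinfty_sub WO CH.
Qed.

(* [F] restricted to the affine subspace of the [z0 + u *m B] has Jacobian matrix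
   1 at [z0]. *)
Lemma Cinfty_descend (R : realType) (m n : nat) (W : set 'rV[R]_m)
    (F : 'rV[R]_m -> 'rV[R]_n) (H : 'rV[R]_n -> R) z0 (B : 'M[R]_(n, m)) :
  open W -> W z0 -> (forall j, Cinfty W (fun z => F z 0 j)) ->
  B *m \matrix_(k < m, j < n) pderiv k (fun z => F z 0 j) z0 = 1%:M ->
  Cinfty W (H \o F) -> exists V, [/\ open V, V (F z0) & Cinfty V H].
Proof.
move=> oW Wz0 CF BJ CH.
pose a (u : 'rV[R]_n) := z0 + u *m B.
have a0 : a 0 = z0 by rewrite /a mul0mx addr0.
have Ca U (j : 'I_m) : open U -> Cinfty U (fun u => a u 0 j).
  move=> oU; apply: (@Cinfty_eq R n U (fun u => z0 0 j + \sum_k u 0 k * B k j)) => //.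
    by move=> u _; rewrite !mxE.
  apply: CinftyD => //; first exact: Cinfty_cst.
  apply: Cinfty_sum => // k; apply: CinftyM => //; first exact: Cinfty_coord.
  exact: Cinfty_cst.
have ca : continuous a.
  by move=> u; apply: continuous_row => j; exact: Cinfty_continuous (Ca _ _ openT) _.
pose O := a @^-1` W.
have oO : open O by apply: open_comp => // u _; exact: ca.
have O0 : O 0 by rewrite /O /preimage /= a0.
have CFa (f : 'rV[R]_m -> R) : Cinfty W f -> Cinfty O (f \o a).
  by apply: Cinfty_comp => // j; exact: Ca.
have da k i (u : 'rV[R]_n) : derivable (fun u => a u 0 k) u (delta_mx 0 i) /\
    pderiv i (fun u => a u 0 k) u = B i k.
  have E : (fun t : R => a (u + t *: delta_mx 0 i) 0 k) = (fun t : R => a u 0 k + t * B i k).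
    apply/funext => t; rewrite /a mulmxDl -scalemxAl -rowE addrA mxE [X in _ + X]mxE.
    by rewrite [X in _ * X]mxE.
  have [d1 d2] : is_derive (0 : R) (1 : R) (fun t : R => a u 0 k + t * B i k) (B i k).
    have dk : is_derive (0 : R) (1 : R) (fun t : R => t * B i k) (B i k).
      by apply: is_derive_eq; rewrite scaler0 add0r /GRing.scale /= mulr1.
    by apply: is_derive_eq (is_deriveD (is_derive_cst (a u 0 k) (0 : R) (1 : R)) dk) _;
      rewrite add0r.
  split; first by apply/derivable_line; rewrite E.
  by rewrite pderivE -derive_line E.
rewrite -a0; apply: (@Cinfty_descend_square R n O (F \o a) H 0) => //.
- by move=> j; exact: CFa (CF j).
- move=> i j; have dF : differentiable (fun z => F z 0 j) (a 0).
    by rewrite a0; exact: Cinfty_differentiable oW (CF j) Wz0.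
  rewrite [LHS](@pderiv_comp R n m a (fun z => F z 0 j) 0 i)//; last first.
    by move=> k; have [] := da k i 0.
  move/matrixP: BJ => /(_ i j); rewrite !mxE => <-.
  by apply: eq_bigr => k _; rewrite mxE (da k i 0).2 a0.
- exact: CFa CH.
Qed.

(** * Smooth functions and tangent vectors on manifolds *)

Lemma chart_im_inv (R : realType) (T : topologicalType) (c : chart R T) (U : set T) z :
  is_chart c -> (cmap c @` (cdom c `&` U)) z ->
  [/\ cdom c (cinv c z), U (cinv c z) & cmap c (cinv c z) = z].
Proof. by move=> [_ _ cK _ _] [x [cx Ux] <-]; rewrite cK ?inE. Qed.

Lemma open_chart_im (R : realType) (T : topologicalType) (c : chart R T) (U : set T) :
  is_chart c -> open U -> open (cmap c @` (cdom c `&` U)).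
Proof.
move=> Hc oU; have [oc oi cK cc ci] := Hc.
rewrite openE => z Uz; have [cz Uz' zz] := chart_im_inv Hc Uz.
have iz : (cmap c @` cdom c) z by exists (cinv c z).
have H1 : \forall w \near z, (cmap c @` cdom c) w by exact: open_nbhs_nbhs.
have H2 : \forall w \near z, U (cinv c w).
  by apply: (ci z (mem_set iz)); exact: open_nbhs_nbhs.
by apply: filterS2 H1 H2 => w [x cx <-]; rewrite cK ?inE// => Ux; exists x.
Qed.

Lemma manifold_chart (R : realType) (M : manifold R) (c : chart R M) :
  atlas M c -> is_chart c.
Proof. by have [_ _ Hc _ _] := manifoldP M; exact: Hc. Qed.

Lemma manifold_cover (R : realType) (M : manifold R) (x : M) :
  exists2 c, atlas M c & cdom c x.
Proof. by have [_ _ _ Hc _] := manifoldP M; exact: Hc. Qed.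

Lemma open_cdom (R : realType) (M : manifold R) (c : chart R M) :
  atlas M c -> open (cdom c).
Proof. by move=> /manifold_chart[]. Qed.

Lemma cmapK (R : realType) (M : manifold R) (c : chart R M) x :
  atlas M c -> cdom c x -> cinv c (cmap c x) = x.
Proof. by move=> /manifold_chart[_ _ cK _ _] cx; rewrite cK ?inE. Qed.


Lemma smooth_on_sub (R : realType) (M : manifold R) (U V : set M) f :
  V `<=` U -> smooth_on U f -> smooth_on V f.
Proof.
move=> VU sf c Mc; apply: Cinfty_sub (sf c Mc).
by move=> z [x [cx /VU Ux] <-]; exists x.
Qed.

Lemma smooth_on_local (R : realType) (M : manifold R) (U : set M) f :
  (forall x, U x -> exists2 V, V x & smooth_on V f) -> smooth_on U f.
Proof.
move=> Uf c Mc; apply: Cinfty_near => _ [x [cx /Uf[V Vx sf]] <-].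
by exists (cmap c @` (cdom c `&` V)); split; [exists x|exact: sf].
Qed.

Lemma smooth_on_eq (R : realType) (M : manifold R) (U : set M) f g :
  open U -> (forall x, U x -> f x = g x) -> smooth_on U f -> smooth_on U g.
Proof.
move=> oU fg sf c Mc; have Hc := manifold_chart Mc.
apply: Cinfty_eq (open_chart_im Hc oU) _ (sf c Mc) => z Uz.
by have [_ /fg] := chart_im_inv Hc Uz.
Qed.

Lemma smooth_on_cst (R : realType) (M : manifold R) (U : set M) (a : R) :
  smooth_on U (fun=> a).
Proof. by move=> c _; exact: Cinfty_cst. Qed.

Lemma smooth_onD (R : realType) (M : manifold R) (U : set M) f g : open U ->
  smooth_on U f -> smooth_on U g -> smooth_on U (fun x => f x + g x).
Proof.
move=> oU sf sg c Mc; apply: CinftyD (sf c Mc) (sg c Mc).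
exact: open_chart_im (manifold_chart Mc) oU.
Qed.

Lemma smooth_onM (R : realType) (M : manifold R) (U : set M) f g : open U ->
  smooth_on U f -> smooth_on U g -> smooth_on U (fun x => f x * g x).
Proof.
move=> oU sf sg c Mc; apply: CinftyM (sf c Mc) (sg c Mc).
exact: open_chart_im (manifold_chart Mc) oU.
Qed.

Lemma smooth_on_sum (R : realType) (M : manifold R) (U : set M) (n : nat)
    (f : 'I_n -> M -> R) : open U ->
  (forall i, smooth_on U (f i)) -> smooth_on U (fun x => \sum_i f i x).
Proof.
move=> oU sf c Mc; apply: Cinfty_sum; first exact: open_chart_im (manifold_chart Mc) oU.
by move=> i; exact: sf.
Qed.

Lemma smooth_on_coord (R : realType) (M : manifold R) (c : chart R M) j :
  atlas M c -> smooth_on (cdom c) (fun x => cmap c x 0 j).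
Proof. by move=> Mc d Md; have [_ _ _ _ H] := manifoldP M; exact: H. Qed.

Lemma smooth_on_chart (R : realType) (M : manifold R) (c : chart R M)
    (O : set 'rV[R]_(cdim c)) (U : set M) g :
  atlas M c -> open O -> open U -> U `<=` cdom c -> (forall x, U x -> O (cmap c x)) ->
  Cinfty O g -> smooth_on U (fun x => g (cmap c x)).
Proof.
move=> Mc oO oU Uc UO Cg d Md; have Hd := manifold_chart Md.
have oi := open_chart_im Hd oU.
apply: (@Cinfty_comp _ _ _ _ O (fun z => cmap c (cinv d z)) g oi oO) => //.
  by move=> z Uz; have [_ Uz' _] := chart_im_inv Hd Uz; exact: UO.
by move=> j; exact: (smooth_on_sub Uc (smooth_on_coord j Mc)).
Qed.

Lemma smooth_map_id (R : realType) (M : manifold R) : @smooth_map R M M id.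
Proof.
split; first by move=> x; exact: cvg_id.
by move=> c d Mc Md j; exact: smooth_on_coord.
Qed.

Lemma smooth_on_comp (R : realType) (M N : manifold R) (F : M -> N) (V : set N) f :
  smooth_map F -> open V -> smooth_on V f -> smooth_on (F @^-1` V) (f \o F).
Proof.
move=> [cF sF] oV sf; apply: smooth_on_local => x Vx.
have [d Nd dx] := manifold_cover (F x); have Hd := manifold_chart Nd.
have oFd : open (F @^-1` (V `&` cdom d)).
  by apply: open_comp => [y _|]; [exact: cF|apply: openI => //; exact: open_cdom].
exists (F @^-1` (V `&` cdom d)) => //.
move=> c Mc; have Hc := manifold_chart Mc; have oi := open_chart_im Hc oFd.
apply: (@Cinfty_eq _ _ _ ((fun w => f (cinv d w)) \o (fun z => cmap d (F (cinv c z))))) => //.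
  by move=> z Fz /=; have [_ [_ dz] _] := chart_im_inv Hc Fz; rewrite cmapK.
apply: (@Cinfty_comp _ _ _ _ (cmap d @` (cdom d `&` V))) => //.
- exact: open_chart_im.
- by move=> z Fz; have [_ [Vz dz] _] := chart_im_inv Hc Fz; exists (F (cinv c z)).
- move=> j; apply: Cinfty_sub (sF c d Mc Nd j).
  by move=> _ [y [cy [_ dy]] <-]; exists y.
- exact: sf.
Qed.

Lemma smooth_at_comp (R : realType) (M N : manifold R) (F : M -> N) x f :
  smooth_map F -> smooth_at (F x) f -> smooth_at x (f \o F).
Proof.
move=> sF [V [oV Vx sf]]; exists (F @^-1` V); split => //.
  by apply: open_comp => // y _; exact: sF.1.
exact: smooth_on_comp.
Qed.

Lemma smooth_on_at (R : realType) (M : charted_space R) (U : set M) x f :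
  open U -> U x -> smooth_on U f -> smooth_at x f.
Proof. by move=> oU Ux sf; exists U. Qed.

Lemma smooth_at2 (R : realType) (M : manifold R) (x : M) f g :
  smooth_at x f -> smooth_at x g ->
  exists U, [/\ open U, U x, smooth_on U f & smooth_on U g].
Proof.
move=> [U [oU Ux sf]] [V [oV Vx sg]]; exists (U `&` V); split => //.
- exact: openI.
- by apply: smooth_on_sub sf => y [].
- by apply: smooth_on_sub sg => y [].
Qed.

Lemma smooth_atD (R : realType) (M : manifold R) (x : M) f g :
  smooth_at x f -> smooth_at x g -> smooth_at x (fun y => f y + g y).
Proof.
by move=> sf sg; have [U [oU Ux ? ?]] := smooth_at2 sf sg;
  exists U; split; [exact: oU|exact: Ux|exact: smooth_onD].
Qed.

Lemma smooth_atM (R : realType) (M : manifold R) (x : M) f g :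
  smooth_at x f -> smooth_at x g -> smooth_at x (fun y => f y * g y).
Proof.
by move=> sf sg; have [U [oU Ux ? ?]] := smooth_at2 sf sg;
  exists U; split; [exact: oU|exact: Ux|exact: smooth_onM].
Qed.

Lemma smooth_at_cst (R : realType) (M : manifold R) (x : M) (a : R) : smooth_at x (fun=> a).
Proof. by exists setT; split=> //; [exact: openT|exact: smooth_on_cst]. Qed.

Lemma smooth_at_sum (R : realType) (M : manifold R) (x : M) (n : nat) (f : 'I_n -> M -> R) :
  (forall i, smooth_at x (f i)) -> smooth_at x (fun y => \sum_i f i y).
Proof.
move=> sf; elim: (index_enum _) => [|i r IH].
  by under eq_fun do rewrite big_nil; exact: smooth_at_cst.
by under eq_fun do rewrite big_cons; exact: (smooth_atD (sf i) IH).
Qed.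

Lemma smooth_at_near (R : realType) (M : manifold R) (x : M) f g :
  (\forall y \near x, f y = g y) -> smooth_at x f -> smooth_at x g.
Proof.
move=> fg [U [oU Ux sf]]; have : nbhs x [set y | f y = g y] by [].
rewrite nbhsE /= => -[V [oV Vx] {}fg].
exists (U `&` V); split=> //; first exact: openI.
apply: (@smooth_on_eq _ _ _ f); first exact: openI.
  by move=> y [_ /fg].
by apply: smooth_on_sub sf => y [].
Qed.

(** * Coordinate vector fields as operators on functions *)

Definition cder (R : realType) (M : charted_space R) (c : chart R M) (x : M)
    (i : 'I_(cdim c)) (f : M -> R) : R :=
  pderiv i (fun z => f (cinv c z)) (cmap c x).
Arguments cder {R M} c x i f.

Lemma smooth_at_chart (R : realType) (M : manifold R) (c : chart R M) x f :
  atlas M c -> cdom c x -> smooth_at x f ->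
  exists O, [/\ open O, O (cmap c x), Cinfty O (fun z => f (cinv c z)) &
    forall z, O z -> cdom c (cinv c z) /\ cmap c (cinv c z) = z].
Proof.
move=> Mc cx [U [oU Ux sf]]; have Hc := manifold_chart Mc.
exists (cmap c @` (cdom c `&` U)); split; [exact: open_chart_im|by exists x|exact: sf|].
by move=> z /(chart_im_inv Hc)[].
Qed.

Lemma cder_cst (R : realType) (M : manifold R) (c : chart R M) x i (a : R) :
  cder c x i (fun=> a) = 0.
Proof. by rewrite /cder pderivE; exact: derive_cst. Qed.

Lemma cderD (R : realType) (M : manifold R) (c : chart R M) x i f g :
  atlas M c -> cdom c x -> smooth_at x f -> smooth_at x g ->
  cder c x i (fun y => f y + g y) = cder c x i f + cder c x i g.
Proof.
move=> Mc cx /(smooth_at_chart Mc cx)[U [oU Ux Cf _]] /(smooth_at_chart Mc cx)[V [oV Vx Cg _]].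
have df := Cinfty_derivable (i := i) Cf Ux; have dg := Cinfty_derivable (i := i) Cg Vx.
by rewrite /cder !pderivE; exact: (deriveD df dg).
Qed.

Lemma cderM (R : realType) (M : manifold R) (c : chart R M) x i f g :
  atlas M c -> cdom c x -> smooth_at x f -> smooth_at x g ->
  cder c x i (fun y => f y * g y) = cder c x i f * g x + f x * cder c x i g.
Proof.
move=> Mc cx /(smooth_at_chart Mc cx)[U [oU Ux Cf _]] /(smooth_at_chart Mc cx)[V [oV Vx Cg _]].
have df := Cinfty_derivable (i := i) Cf Ux; have dg := Cinfty_derivable (i := i) Cg Vx.
rewrite /cder !pderivE; apply: etrans (deriveM df dg) _.
by rewrite !(cmapK Mc cx) /GRing.scale /= addrC mulrC.
Qed.

Lemma cder_near (R : realType) (M : manifold R) (c : chart R M) x i f g :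
  atlas M c -> cdom c x -> (\forall y \near x, f y = g y) ->
  cder c x i f = cder c x i g.
Proof.
move=> Mc cx fg; rewrite /cder !pderivE; apply: near_eq_derive.
have [_ oi _ _ ci] := manifold_chart Mc.
have cix : (cmap c @` cdom c) (cmap c x) by exists x.
have := ci _ (mem_set cix); rewrite /continuous_at (cmapK Mc cx) => cv.
exact: (cv _ fg).
Qed.

Lemma cder_coord (R : realType) (M : manifold R) (c : chart R M) x i j :
  atlas M c -> cdom c x -> cder c x i (fun y => cmap c y 0 j) = (j == i)%:R.
Proof.
move=> Mc cx; have Hc := manifold_chart Mc; have [_ oi _ _ _] := Hc.
rewrite /cder (@eq_on_pderiv _ _ (cmap c @` cdom c) _ (fun z => z 0 j))//.
- by have [_] := pderiv_coord i j (cmap c x).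
by move=> _ [y cy <-]; rewrite cmapK.
Qed.

Lemma smooth_on_cder (R : realType) (M : manifold R) (c : chart R M) i (U : set M) f :
  atlas M c -> open U -> U `<=` cdom c -> smooth_on U f ->
  smooth_on U (fun x => cder c x i f).
Proof.
move=> Mc oU Uc sf; have Hc := manifold_chart Mc.
apply: (smooth_on_chart Mc (open_chart_im Hc oU) oU Uc).
  by move=> x Ux; exists x => //; split=> //; exact: Uc.
exact: Cinfty_pderiv (sf c Mc).
Qed.

Lemma smooth_at_cder (R : realType) (M : manifold R) (c : chart R M) i x f :
  atlas M c -> cdom c x -> smooth_at x f -> smooth_at x (fun y => cder c y i f).
Proof.
move=> Mc cx [U [oU Ux sf]]; exists (U `&` cdom c); split=> //.
  exact: openI oU (open_cdom Mc).
apply: smooth_on_cder => //; first exact: openI oU (open_cdom Mc).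
by apply: smooth_on_sub sf => y [].
Qed.

Lemma smooth_at_coord (R : realType) (M : manifold R) (c : chart R M) j x :
  atlas M c -> cdom c x -> smooth_at x (fun y => cmap c y 0 j).
Proof. by move=> Mc cx; exists (cdom c); split=> //; [exact: open_cdom|exact: smooth_on_coord]. Qed.

Lemma cderC (R : realType) (M : manifold R) (c : chart R M) i j x f :
  atlas M c -> cdom c x -> smooth_at x f ->
  cder c x i (fun y => cder c y j f) = cder c x j (fun y => cder c y i f).
Proof.
move=> Mc cx /(smooth_at_chart Mc cx)[W [oW Wx Cf WK]].
(* In the chart, the inner derivative is evaluated at [cmap c (cinv c z)], which is [z] only on the
   chart image; an equality on an open set is enough to differentiate. *)
have E k l : cder c x k (fun y => cder c y l f) =
    pderiv k (pderiv l (fun z => f (cinv c z))) (cmap c x).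
  apply: (eq_on_pderiv _ oW _ Wx) => z /WK[_ zz].
  by rewrite /cder zz.
rewrite !E; apply: (pderivC _ _ oW _ Wx); exact: (CinftyP _ _).1.
Qed.

Lemma cder_chain (R : realType) (M N : manifold R) (F : M -> N) (c : chart R M)
    (d : chart R N) i x f :
  atlas M c -> atlas N d -> smooth_map F -> cdom c x -> cdom d (F x) ->
  smooth_at (F x) f ->
  cder c x i (f \o F) =
    \sum_j cder c x i (fun y => cmap d (F y) 0 j) * cder d (F x) j f.
Proof.
move=> Mc Nd sF cx dx sf.
have [W [oW Wx Cf WK]] := smooth_at_chart Nd dx sf.
have nd : \forall y \near x, cdom d (F y).
  by apply: (sF.1 x); exact: open_nbhs_nbhs (conj (open_cdom Nd) dx).
have Ck' j : smooth_at x (fun y => cmap d (F y) 0 j).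
  exact: (smooth_at_comp sF (smooth_at_coord j Nd dx)).
transitivity (cder c x i (fun y => f (cinv d (cmap d (F y))))).
  apply: cder_near => //.
  by apply: filterS nd => y dy /=; rewrite cmapK.
rewrite /cder [LHS](@pderiv_comp _ _ _ (fun z => cmap d (F (cinv c z)))
   (fun w => f (cinv d w)) (cmap c x) i); last 2 first.
- by move=> j; have [U [oU Ux Cj _]] := smooth_at_chart Mc cx (Ck' j);
    exact: Cinfty_derivable Cj Ux.
- by rewrite (cmapK Mc cx); exact: Cinfty_differentiable oW Cf Wx.
by rewrite (cmapK Mc cx).
Qed.

(** * Tangent vectors, tangent maps and Lie brackets *)

Lemma tangent_ext (R : realType) (M : manifold R) (x : M) (u v : tangent x) :
  (forall f, smooth_at x f -> u f = v f) -> u = v.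
Proof.
move=> uv; apply: val_inj; apply/funext => f /=.
(* On functions that are not smooth near [x] both vectors are 0 by convention. *)
have [/uv//|nf] := pselect (smooth_at x f).
have /asboolP[_ u0] := tangentP u; have /asboolP[_ v0] := tangentP v.
by rewrite u0// v0.
Qed.

Lemma tangent_cder (R : realType) (M : manifold R) (x : M) (v : tangent x) (c : chart R M) :
  atlas M c -> cdom c x -> exists a : 'I_(cdim c) -> R, forall f, smooth_at x f ->
    v f = \sum_i a i * cder c x i f.
Proof.
move=> Mc cx; have /asboolP[/(_ c Mc cx)[a va] _] := tangentP v.
by exists (fun i => a 0 i) => f /va.
Qed.

(** Evaluation on the coordinate functions identifies the coefficients of [v]. *)
Lemma tangent_chart (R : realType) (M : manifold R) (x : M) (v : tangent x) (c : chart R M) f :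
  atlas M c -> cdom c x -> smooth_at x f ->
  v f = \sum_i v (fun y => cmap c y 0 i) * cder c x i f.
Proof.
move=> Mc cx sf; have [a va] := tangent_cder v Mc cx.
rewrite va//; apply: eq_bigr => i _; congr (_ * _).
rewrite va; last exact: smooth_at_coord.
rewrite (bigD1 i)//= cder_coord// eqxx mulr1 big1 ?addr0// => j ji.
by rewrite cder_coord// eq_sym (negbTE ji) mulr0.
Qed.

(* The coordinate formula in a single chart suffices, by [cder_chain]. *)
Lemma tangent_exists (R : realType) (M : manifold R) (x : M) (c : chart R M)
    (a : 'I_(cdim c) -> R) :
  atlas M c -> cdom c x ->
  exists v : tangent x, forall f, smooth_at x f -> v f = \sum_i a i * cder c x i f.
Proof.
move=> Mc cx.
pose L (f : M -> R) : R^o := if `[< smooth_at x f >] then \sum_i a i * cder c x i f else 0.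
have Lf f : smooth_at x f -> L f = \sum_i a i * cder c x i f by rewrite /L => /asboolT ->.
have Lx : L \in tangent_pred x.
  apply/asboolP; split=> [d Md dx|f /asboolPn/negbTE nf]; last by rewrite /L nf.
  exists (\row_j \sum_i a i * cder c x i (fun y => cmap d y 0 j)) => f sf; rewrite Lf//.
  transitivity (\sum_i a i * cder c x i (f \o id)) => //.
  under eq_bigr do rewrite (cder_chain _ Mc Md (smooth_map_id M) cx dx sf) mulr_sumr.
  rewrite exchange_big /=; apply: eq_bigr => j _; rewrite mxE mulr_suml.
  by apply: eq_bigr => i _; rewrite mulrA.
by exists (Tangent Lx).
Qed.

(** Total in [x], so that [coord_vec c i] is a vector field on all of [M]; its values are meaningful
    on [cdom c] only. *)
Definition coord_vec (R : realType) (M : charted_space R) (c : chart R M) (i : 'I_(cdim c))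
    (x : M) : tangent x :=
  xget 0 [set v : tangent x | forall f, smooth_at x f -> v f = cder c x i f].
Arguments coord_vec {R M} c i x.

Lemma coord_vecE (R : realType) (M : manifold R) (c : chart R M) i (x : M) f :
  atlas M c -> cdom c x -> smooth_at x f -> coord_vec c i x f = cder c x i f.
Proof.
move=> Mc cx; rewrite /coord_vec; case: xgetP => [v _ /(_ f)//|nv].
have [v vE] := tangent_exists (fun j => (j == i)%:R) Mc cx.
have /nv[] : [set v : tangent x | forall f, smooth_at x f -> v f = cder c x i f] v.
move=> g sg; rewrite vE// (bigD1 i)//= eqxx mul1r big1 ?addr0// => j ji.
by rewrite (negbTE ji) mul0r.
Qed.

Lemma tangentE_add (R : realType) (M : charted_space R) (x : M) (k : R) (u v : tangent x) f :
  (k *: u + v) f = k * u f + v f.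
Proof. by []. Qed.

Lemma tangentE_sum (R : realType) (M : charted_space R) (x : M) (n : nat)
    (k : 'I_n -> R) (u : 'I_n -> tangent x) f :
  (\sum_i k i *: u i) f = \sum_i k i * u i f.
Proof.
elim: (index_enum _) => [|i r IH]; first by rewrite !big_nil.
by rewrite !big_cons tangentE_add IH.
Qed.

Lemma tangent_basis (R : realType) (M : manifold R) (x : M) (v : tangent x) (c : chart R M) :
  atlas M c -> cdom c x -> v = \sum_i v (fun y => cmap c y 0 i) *: coord_vec c i x.
Proof.
move=> Mc cx; apply: tangent_ext => f sf; rewrite tangentE_sum (tangent_chart v Mc cx sf).
by apply: eq_bigr => i _; rewrite coord_vecE.
Qed.

Lemma tangent_cst (R : realType) (M : manifold R) (x : M) (v : tangent x) (a : R) :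
  v (fun=> a) = 0.
Proof.
have [c Mc cx] := manifold_cover x; rewrite (tangent_chart v Mc cx); last exact: smooth_at_cst.
by rewrite big1// => i _; rewrite cder_cst mulr0.
Qed.

Lemma tangent_add (R : realType) (M : manifold R) (x : M) (v : tangent x) f g :
  smooth_at x f -> smooth_at x g -> v (fun y => f y + g y) = v f + v g.
Proof.
move=> sf sg; have [c Mc cx] := manifold_cover x.
rewrite (tangent_chart v Mc cx (smooth_atD sf sg)) (tangent_chart v Mc cx sf).
rewrite (tangent_chart v Mc cx sg).
rewrite -big_split; apply: eq_bigr => i _.
by rewrite (cderD i Mc cx sf sg) mulrDr.
Qed.

Lemma tangent_mul (R : realType) (M : manifold R) (x : M) (v : tangent x) f g :
  smooth_at x f -> smooth_at x g -> v (fun y => f y * g y) = v f * g x + f x * v g.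
Proof.
move=> sf sg; have [c Mc cx] := manifold_cover x.
rewrite (tangent_chart v Mc cx (smooth_atM sf sg)) (tangent_chart v Mc cx sf).
rewrite (tangent_chart v Mc cx sg).
rewrite mulr_suml mulr_sumr -big_split; apply: eq_bigr => i _.
rewrite (cderM i Mc cx sf sg) mulrDr mulrA; congr (_ + _); exact: mulrCA.
Qed.

Lemma tangent_near (R : realType) (M : manifold R) (x : M) (v : tangent x) f g :
  smooth_at x f -> (\forall y \near x, f y = g y) -> v f = v g.
Proof.
move=> sf fg; have sg := smooth_at_near fg sf.
have [c Mc cx] := manifold_cover x; rewrite !(tangent_chart v Mc cx)//.
by apply: eq_bigr => i _; rewrite (cder_near i Mc cx fg).
Qed.

Lemma tangent_sum (R : realType) (M : manifold R) (x : M) (v : tangent x) (n : nat)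
    (f : 'I_n -> M -> R) : (forall i, smooth_at x (f i)) ->
  v (fun y => \sum_i f i y) = \sum_i v (f i).
Proof.
move=> sf.
suff [] : smooth_at x (fun y => \sum_i f i y) /\ v (fun y => \sum_i f i y) = \sum_i v (f i) by [].
elim: (index_enum _) => [|i r [IH1 IH2]].
  under eq_fun do rewrite big_nil; rewrite big_nil.
  by split; [exact: smooth_at_cst|exact: tangent_cst].
under eq_fun do rewrite big_cons; rewrite big_cons; split; first exact: (smooth_atD (sf i) IH1).
by rewrite (tangent_add v (sf i) IH1) IH2.
Qed.

Lemma scalar_differential (R : realType) (M : charted_space R) (x : M) f :
  scalar (differential f (x := x)).
Proof. by []. Qed.

(** The vector whose coordinates are the values of [v] on the coordinates of [F] has the required
    action, by the chain rule; so the choice in [push] does not fall back on 0. *)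
Lemma pushE (R : realType) (M N : manifold R) (F : M -> N) x y (v : tangent x) f :
  smooth_map F -> F x = y -> smooth_at y f -> push F y v f = v (f \o F).
Proof.
move=> sF Fx; rewrite -{}Fx {y}; rewrite /push; case: xgetP => [w _ /(_ f)//|nw].
have [c Mc cx] := manifold_cover x; have [d Nd dx] := manifold_cover (F x).
have [w wE] := tangent_exists (fun j => v (fun y => cmap d (F y) 0 j)) Nd dx.
have /nw[] : [set w : tangent (F x) | forall f, smooth_at (F x) f -> w f = v (f \o F)] w.
move=> g sg; rewrite wE// (tangent_chart v Mc cx (smooth_at_comp sF sg)).
under [RHS]eq_bigr do rewrite (cder_chain _ Mc Nd sF cx dx sg) mulr_sumr.
rewrite exchange_big /=; apply: eq_bigr => j _.
rewrite (tangent_chart v Mc cx (smooth_at_comp sF (smooth_at_coord j Nd dx))) mulr_suml.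
by apply: eq_bigr => i _; rewrite mulrA.
Qed.

Lemma scalar_push (R : realType) (M N : manifold R) (F : M -> N) x y (al : tangent y -> R) :
  smooth_map F -> F x = y -> scalar al -> scalar (al \o @push R M N F x y).
Proof.
move=> sF Fx sal k u v /=; rewrite -sal; congr al; apply: tangent_ext => f sf.
by rewrite tangentE_add !pushE.
Qed.

Lemma smooth_field_at (R : realType) (M : manifold R) (X : vector_field M) x f :
  smooth_vector_field_at x X -> smooth_at x f -> smooth_at x (fun y => X y f).
Proof.
move=> [U [oU Ux sX]] [V [oV Vx sf]].
have oUV : open (U `&` V) by exact: openI.
exists (U `&` V); split; [exact: oUV|by []|apply: (sX _ f oUV)].
  by move=> y [].
by apply: smooth_on_sub sf => y [].
Qed.

(* In a chart, the second derivatives of [f] cancel in [X (Y f) - Y (X f)]. *)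
Lemma field_field_chart (R : realType) (M : manifold R) (X Y : vector_field M) x
    (c : chart R M) f :
  atlas M c -> cdom c x -> smooth_vector_field_at x Y -> smooth_at x f ->
  X x (fun y => Y y f) =
    \sum_j X x (fun y => Y y (fun z => cmap c z 0 j)) * cder c x j f +
    \sum_j \sum_i (Y x (fun z => cmap c z 0 j) * X x (fun z => cmap c z 0 i)) *
      cder c x i (fun y => cder c y j f).
Proof.
move=> Mc cx sY sf.
have sc j : smooth_at x (fun z => cmap c z 0 j) by exact: smooth_at_coord.
have sYc j : smooth_at x (fun y => Y y (fun z => cmap c z 0 j)) by exact: smooth_field_at sY (sc j).
have sd j : smooth_at x (fun y => cder c y j f) by exact: smooth_at_cder.
(* Needed near [x] and not only at [x], because [X x] differentiates it. *)
have E : \forall y \near x,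
    Y y f = \sum_j Y y (fun z => cmap c z 0 j) * cder c y j f.
  have [U [oU Ux sf']] := sf.
  have nU : \forall y \near x, U y by exact: open_nbhs_nbhs (conj oU Ux).
  have nc : \forall y \near x, cdom c y by exact: open_nbhs_nbhs (conj (open_cdom Mc) cx).
  apply: filterS2 nU nc => y Uy cy; apply: (tangent_chart (Y y) Mc cy).
  exact: smooth_on_at oU Uy sf'.
rewrite (tangent_near (X x) (smooth_field_at sY sf) E) tangent_sum; last first.
  by move=> j; exact: smooth_atM (sYc j) (sd j).
rewrite -big_split; apply: eq_bigr => j _.
rewrite (tangent_mul (X x) (sYc j) (sd j)); congr (_ + _).
rewrite (tangent_chart (X x) Mc cx (sd j)) mulr_sumr; apply: eq_bigr => i _.
by rewrite mulrA.
Qed.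

(** The candidate has coordinates [X (Y x_j) - Y (X x_j)]. It acts as the commutator on every [f]
    because the second-order terms agree by [cderC]. *)
Lemma lie_bracketE (R : realType) (M : manifold R) (X Y : vector_field M) x f :
  smooth_vector_field_at x X -> smooth_vector_field_at x Y -> smooth_at x f ->
  lie_bracket X Y x f = X x (fun y => Y y f) - Y x (fun y => X y f).
Proof.
move=> sX sY; rewrite /lie_bracket; case: xgetP => [Z _ /(_ f)//|nZ].
have [c Mc cx] := manifold_cover x.
have [Z ZE] := tangent_exists (fun j => X x (fun y => Y y (fun z => cmap c z 0 j)) -
  Y x (fun y => X y (fun z => cmap c z 0 j))) Mc cx.
have /nZ[] : [set Z : tangent x | forall f, smooth_at x f ->
    Z f = X x (fun y => Y y f) - Y x (fun y => X y f)] Z.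
move=> g sg; rewrite ZE// (field_field_chart X Mc cx sY sg) (field_field_chart Y Mc cx sX sg).
under eq_bigr do rewrite mulrBl.
rewrite sumrB opprD addrACA -[LHS]addr0; congr (_ + _); apply/esym/eqP.
rewrite subr_eq0 exchange_big /=; apply/eqP; apply: eq_bigr => j _; apply: eq_bigr => i _.
by rewrite (cderC i j Mc cx sg) [X in X * _]mulrC.
Qed.

(** * Covectors and the local form of bivectors *)

Lemma scalar_sum (R : realType) (V : lmodType R) (al : V -> R) (n : nat)
    (k : 'I_n -> R) (v : 'I_n -> V) : scalar al ->
  al (\sum_i k i *: v i) = \sum_i k i * al (v i).
Proof.
move=> sal; have al0 : al 0 = 0.
  have := sal 1 0 0; rewrite scaler0 addr0 mul1r => E.
  by apply: (addrI (al 0)); rewrite addr0 -E.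
elim: (index_enum _) => [|i r IH]; first by rewrite !big_nil.
by rewrite !big_cons sal IH.
Qed.

Lemma bilinear_sum (R : realType) (V : lmodType R) (B : (V -> R) -> (V -> R) -> R)
    (n : nat) (k : 'I_n -> R) (f : 'I_n -> V -> R) ga :
  bilinear_form B -> (forall i, scalar (f i)) -> scalar ga ->
  B (fun v => \sum_i k i * f i v) ga = \sum_i k i * B (f i) ga /\
  B ga (fun v => \sum_i k i * f i v) = \sum_i k i * B ga (f i).
Proof.
move=> bB sf sga.
have s0 : scalar (fun _ : V => 0 : R).
  by move=> a u v; rewrite -[RHS]/(a * 0 + 0) mulr0 addr0.
have B0 : B (fun=> 0) ga = 0 /\ B ga (fun=> 0) = 0.
  have := bB 1 _ _ ga s0 s0 sga; under eq_fun do rewrite mulr0 addr0.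
  rewrite !mul1r => -[E1 E2]; split; apply/eqP.
    by rewrite -(inj_eq (addrI (B (fun=> 0) ga))) -E1 addr0.
  by rewrite -(inj_eq (addrI (B ga (fun=> 0)))) -E2 addr0.
(* [bilinear_form] speaks only of linear arguments, so the linearity of the partial sums is carried
   along in the induction. *)
suff [] : scalar (fun v => \sum_i k i * f i v) /\
  (B (fun v => \sum_i k i * f i v) ga = \sum_i k i * B (f i) ga /\
  B ga (fun v => \sum_i k i * f i v) = \sum_i k i * B ga (f i)) by [].
elim: (index_enum _) => [|i r [IHs [IH1 IH2]]].
  by rewrite !big_nil; under eq_fun do rewrite big_nil; split.
rewrite !big_cons; under eq_fun do rewrite big_cons; split.
  by move=> a u v; rewrite sf IHs; ring.
by have [-> ->] := bB (k i) _ _ ga (sf i) IHs sga; rewrite IH1 IH2.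
Qed.

Lemma covector_basis (R : realType) (M : manifold R) (x : M) (c : chart R M)
    (al : tangent x -> R) : atlas M c -> cdom c x -> scalar al ->
  al = (fun v => \sum_i al (coord_vec c i x) * differential (fun y => cmap c y 0 i) v).
Proof.
move=> Mc cx sal; apply/funext => v; rewrite {1}(tangent_basis v Mc cx) scalar_sum//.
by apply: eq_bigr => i _; rewrite mulrC.
Qed.

(** A combination of coordinate functions with constant coefficients; it is claimed to be smooth
    only near [x]. *)
Lemma covector_differential (R : realType) (M : manifold R) (x : M) (al : tangent x -> R) :
  scalar al -> exists2 f, smooth_at x f & al = differential f (x := x).
Proof.
move=> sal; have [c Mc cx] := manifold_cover x.
have sc i : smooth_at x (fun y => al (coord_vec c i x) * cmap c y 0 i).
  by apply: smooth_atM; [exact: smooth_at_cst|exact: smooth_at_coord].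
exists (fun y => \sum_i al (coord_vec c i x) * cmap c y 0 i); first exact: smooth_at_sum.
rewrite {1}(covector_basis Mc cx sal); apply/funext => v.
rewrite /differential tangent_sum//; apply: eq_bigr => i _.
rewrite tangent_mul; [|exact: smooth_at_cst|exact: smooth_at_coord].
by rewrite tangent_cst mul0r add0r.
Qed.

Lemma bivector_chart (R : realType) (M : manifold R) (P : form2_field M) (x : M)
    (c : chart R M) (al be : tangent x -> R) :
  atlas M c -> cdom c x -> bivector (P x) -> scalar al -> scalar be ->
  P x al be = \sum_i \sum_j al (coord_vec c i x) * (be (coord_vec c j x) *
    bracket_of P (fun y => cmap c y 0 i) (fun y => cmap c y 0 j) x).
Proof.
move=> Mc cx [bP _] sal sbe; rewrite {1}(covector_basis Mc cx sal).
have sd i : scalar (differential (fun y => cmap c y 0 i) (x := x)) by [].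
rewrite (bilinear_sum _ bP sd sbe).1; apply: eq_bigr => i _.
rewrite {1}(covector_basis Mc cx sbe) (bilinear_sum _ bP sd (sd i)).2 mulr_sumr.
by [].
Qed.

(** The hypothesis [is_schouten] gives information at [x] only through a decomposition there. In a
    chart, [P] is the sum of the wedges of the [i]-th coordinate field with half its contraction by
    the coefficients [Pc i j]. *)
Lemma wedge_decomposition_exists (R : realType) (M : manifold R) (P : form2_field M) x :
  bivector_field P ->
  exists n (X Y : 'I_n -> vector_field M), wedge_decomposition P X Y x.
Proof.
move=> [bP sP]; have [c Mc cx] := manifold_cover x.
pose Pc i j := bracket_of P (fun y => cmap c y 0 i) (fun y => cmap c y 0 j).
pose X (i : 'I_(cdim c)) : vector_field M := coord_vec c i.
(* The factor 1/2 is there because each unordered pair of indices occurs twice. *)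
pose Y (i : 'I_(cdim c)) : vector_field M :=
  fun y => \sum_j (2^-1 * Pc i j y) *: coord_vec c j y.
have sE i (V : set M) f : open V -> V `<=` cdom c -> smooth_on V f ->
    smooth_on V (fun y => coord_vec c i y f).
  move=> oV Vc sf; apply: (smooth_on_eq oV _ (smooth_on_cder i Mc oV Vc sf)) => y Vy.
  by rewrite coord_vecE//; [exact: Vc|exact: smooth_on_at oV Vy sf].
have oc := open_cdom Mc.
have sPc i j : smooth_on (cdom c) (Pc i j).
  exact: sP oc (smooth_on_coord i Mc) (smooth_on_coord j Mc).
exists (cdim c), X, Y; split.
  move=> i; split; exists (cdom c); split; [exact: oc|exact: cx| |exact: oc|exact: cx|].
    by move=> V f oV Vc sf; exact: sE.
  move=> V f oV Vc sf.
  apply: (@smooth_on_eq _ _ _ (fun y => \sum_j (2^-1 * Pc i j y) * coord_vec c j y f)).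
  - exact: oV.
  - by move=> y _; rewrite /Y tangentE_sum.
  - apply: (smooth_on_sum oV) => j; apply: (smooth_onM oV _ (sE j V f oV Vc sf)).
    have sP1 : smooth_on V (Pc i j) := smooth_on_sub Vc (sPc i j).
    exact: (@smooth_onM R M V (fun=> 2^-1 : R) (Pc i j) oV (@smooth_on_cst R M V (2^-1 : R)) sP1).
have nc : \forall y \near x, cdom c y by exact: open_nbhs_nbhs (conj (open_cdom Mc) cx).
apply: filterS nc => y cy al be sal sbe.
have aY i (ga : tangent y -> R) : scalar ga ->
    ga (Y i y) = \sum_j (2^-1 * Pc i j y) * ga (coord_vec c j y).
  by move=> sga; rewrite /Y scalar_sum.
(* The tensor sum gives half of [P]; since [P] is skew, subtracting the same sum with swapped
   arguments gives [P]. *)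
have E (a b : tangent y -> R) : scalar a -> scalar b ->
    \sum_i a (X i y) * b (Y i y) = 2^-1 * P y a b.
  move=> sa sb; rewrite (bivector_chart Mc cy (bP y) sa sb) mulr_sumr.
  apply: eq_bigr => i _; rewrite aY// !mulr_sumr; apply: eq_bigr => j _.
  by rewrite -[bracket_of _ _ _ _]/(Pc i j y) /X; ring.
under eq_bigr do rewrite /wedge2 [X in _ - X]mulrC.
rewrite sumrB !E// (bP y).2// [P y be al](bP y).2//.
by rewrite !opprK mulrN opprK; move: (P y al be) => p; lra.
Qed.

(** * The Jacobi identity *)

Lemma bracket_decomposition (R : realType) (M : manifold R) (P : form2_field M) n
    (X Y : 'I_n -> vector_field M) x f g :
  wedge_decomposition P X Y x ->
  \forall y \near x, bracket_of P f g y = \sum_i (X i y f * Y i y g - Y i y f * X i y g).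
Proof. by move=> [_]; apply: filterS => y; apply; exact: scalar_differential. Qed.

Lemma smooth_at_opp_mul (R : realType) (M : manifold R) (x : M) f g :
  smooth_at x f -> smooth_at x g -> smooth_at x (fun y => - (f y * g y)) /\
  forall v : tangent x, v (fun y => - (f y * g y)) = - (v f * g x + f x * v g).
Proof.
move=> sf sg; have E : (fun y => - (f y * g y)) = (fun y => (fun=> -1) y * (fun y => f y * g y) y).
  by apply/funext => y; rewrite mulN1r.
have sfg := smooth_atM sf sg; have s1 := smooth_at_cst x (-1 : R).
rewrite E; split=> [|v]; first exact: smooth_atM s1 sfg.
rewrite (tangent_mul v s1 sfg) tangent_cst mul0r add0r (tangent_mul v sf sg).
by rewrite mulN1r.
Qed.

Lemma tangent_bracket (R : realType) (M : manifold R) (P : form2_field M) n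
    (X Y : 'I_n -> vector_field M) x f g (v : tangent x) :
  wedge_decomposition P X Y x -> smooth_at x f -> smooth_at x g ->
  v (bracket_of P f g) = \sum_i
    (v (fun y => X i y f) * Y i x g + X i x f * v (fun y => Y i y g) -
     (v (fun y => Y i y f) * X i x g + Y i x f * v (fun y => X i y g))).
Proof.
move=> dP sf sg; have nE := bracket_decomposition f g dP; have [sXY _] := dP.
have sX i h : smooth_at x h -> smooth_at x (fun y => X i y h).
  by apply: smooth_field_at; exact: (sXY i).1.
have sY i h : smooth_at x h -> smooth_at x (fun y => Y i y h).
  by apply: smooth_field_at; exact: (sXY i).2.
have s1 i : smooth_at x (fun y => X i y f * Y i y g).
  exact: smooth_atM (sX i f sf) (sY i g sg).
have s2 i := smooth_at_opp_mul (sY i f sf) (sX i g sg).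
have s3 i : smooth_at x (fun y => X i y f * Y i y g - Y i y f * X i y g).
  exact: smooth_atD (s1 i) (s2 i).1.
have nE' : \forall y \near x,
  \sum_i (X i y f * Y i y g - Y i y f * X i y g) = bracket_of P f g y.
  by apply: filterS nE => y ->.
rewrite -(tangent_near v (smooth_at_sum s3) nE') (tangent_sum v s3).
apply: eq_bigr => i _.
rewrite (tangent_add v (s1 i) (s2 i).1) ((s2 i).2 v).
by rewrite (tangent_mul v (sX i f sf) (sY i g sg)).
Qed.

(** The outer bracket is expanded in one decomposition and the inner one in another, as the two
    slots of the Schouten bracket require. *)
Lemma bracket_bracket (R : realType) (M : manifold R) (P : form2_field M) m n
    (X Y : 'I_m -> vector_field M) (Z W : 'I_n -> vector_field M) x f g h :
  wedge_decomposition P X Y x -> wedge_decomposition P Z W x ->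
  smooth_at x g -> smooth_at x h ->
  bracket_of P f (bracket_of P g h) x = \sum_i \sum_j
    (X i x f * (Y i x (fun y => Z j y g) * W j x h + Z j x g * Y i x (fun y => W j y h) -
       (Y i x (fun y => W j y g) * Z j x h + W j x g * Y i x (fun y => Z j y h))) -
     Y i x f * (X i x (fun y => Z j y g) * W j x h + Z j x g * X i x (fun y => W j y h) -
       (X i x (fun y => W j y g) * Z j x h + W j x g * X i x (fun y => Z j y h)))).
Proof.
move=> dX dZ sg sh; rewrite (nbhs_singleton (bracket_decomposition f (bracket_of P g h) dX)).
apply: eq_bigr => i _; rewrite !(tangent_bracket _ dZ sg sh) !mulr_sumr.
by rewrite -sumrB.
Qed.

(** A Lie bracket such as [[X, Z]] contains derivatives of [Z] along [X] and of [X] along [Z]. The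
    former occur in the Jacobiator with [X, Y] outside, the latter in the one with [Z, W] outside;
    both copies are needed, hence the 2. *)
Lemma schouten_jacobi (R : realType) (M : manifold R) (P : form2_field M) m n
    (X Y : 'I_m -> vector_field M) (Z W : 'I_n -> vector_field M) x f g h :
  wedge_decomposition P X Y x -> wedge_decomposition P Z W x ->
  smooth_at x f -> smooth_at x g -> smooth_at x h ->
  \sum_i \sum_j schouten_wedge (X i) (Y i) (Z j) (W j)
    (differential f (x := x)) (differential g (x := x)) (differential h (x := x)) =
  2 * (bracket_of P f (bracket_of P g h) x + bracket_of P g (bracket_of P h f) x +
     bracket_of P h (bracket_of P f g) x).
Proof.
move=> dX dZ sf sg sh.
rewrite mulr_natl mulr2n.
(* One copy of the Jacobiator is expanded with [X, Y] outside, the other with [Z, W] outside. *)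
rewrite {1}(bracket_bracket f dX dZ sg sh) {1}(bracket_bracket g dX dZ sh sf).
rewrite {1}(bracket_bracket h dX dZ sf sg) (bracket_bracket f dZ dX sg sh).
rewrite (bracket_bracket g dZ dX sh sf) (bracket_bracket h dZ dX sf sg).
rewrite ![\sum_(j < n) \sum_(i < m) _]exchange_big /= -!big_split.
apply: eq_bigr => i _; rewrite -!big_split; apply: eq_bigr => j _.
have sX := (dX.1 i).1; have sY := (dX.1 i).2; have sZ := (dZ.1 j).1; have sW := (dZ.1 j).2.
rewrite /schouten_wedge /wedge3 /wedge2 /differential.
rewrite !(lie_bracketE sX sZ)// !(lie_bracketE sX sW)// !(lie_bracketE sY sZ)//.
rewrite !(lie_bracketE sY sW)//=.
(* For fixed [i] and [j] the identity is polynomial in the first-order values and in the iterated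
   ones such as [X (Z f)], all taken as independent unknowns. *)
move: (X i x f) (X i x g) (X i x h) (Y i x f) (Y i x g) (Y i x h)
  (Z j x f) (Z j x g) (Z j x h) (W j x f) (W j x g) (W j x h).
move=> a1 a2 a3 a4 a5 a6 a7 a8 a9 a10 a11 a12.
move: (X i x _) (X i x _) (X i x _) (X i x _) (X i x _) (X i x _).
move=> b1 b2 b3 b4 b5 b6.
move: (Y i x _) (Y i x _) (Y i x _) (Y i x _) (Y i x _) (Y i x _).
move=> c1 c2 c3 c4 c5 c6.
move: (Z j x _) (Z j x _) (Z j x _) (Z j x _) (Z j x _) (Z j x _).
move=> d1 d2 d3 d4 d5 d6.
move: (W j x _) (W j x _) (W j x _) (W j x _) (W j x _) (W j x _).
move=> e1 e2 e3 e4 e5 e6.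
ring.
Qed.

(** * Actions and reduction *)

Lemma continuous_pair (T S1 S2 : topologicalType) (f : T -> S1) (g : T -> S2) x :
  {for x, continuous f} -> {for x, continuous g} ->
  {for x, continuous (fun y => (f y, g y))}.
Proof. by move=> cf cg; apply: cvg_pair. Qed.

Lemma eq_continuous (S T : topologicalType) (f g : S -> T) x :
  f =1 g -> {for x, continuous f} -> {for x, continuous g}.
Proof. by move=> /funext ->. Qed.

(** [prod_space] is only a charted space, so [manifold_chart] does not apply to it. *)
Lemma is_chart_prod (R : realType) (S T : topologicalType) (c : chart R S) (d : chart R T) :
  is_chart c -> is_chart d -> is_chart (prod_chart c d).
Proof.
move=> [oc oic cK cc cic] [od oid dK cd cid].
have im w : (cmap (prod_chart c d) @` cdom (prod_chart c d)) w ->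
    (cmap c @` cdom c) (lsubmx w) /\ (cmap d @` cdom d) (rsubmx w).
  move=> [[x y] [/= cx dy] <-]; rewrite row_mxKl row_mxKr.
  by split; [exists x|exists y].
split.
- rewrite (_ : cdom _ = fst @^-1` cdom c `&` snd @^-1` cdom d)//.
  apply: openI.
    by apply: (open_comp _ oc) => w _; exact: cvg_fst.
  by apply: (open_comp _ od) => w _; exact: cvg_snd.
- rewrite (_ : _ @` _ = (fun w => lsubmx w) @^-1` (cmap c @` cdom c) `&`
    (fun w => rsubmx w) @^-1` (cmap d @` cdom d)); last first.
    apply/seteqP; split=> [w /im//|w [[x cx xw] [y dy yw]]].
    by exists (x, y) => //=; rewrite xw yw hsubmxK.
  apply: openI.
    by apply: (open_comp _ oic) => w _; exact: continuous_lsubmx.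
  by apply: (open_comp _ oid) => w _; exact: continuous_rsubmx.
- move=> [x y]; rewrite inE => -[/= cx dy].
  by rewrite row_mxKl row_mxKr cK ?dK ?inE.
- move=> [x y]; rewrite inE => -[/= cx dy]; apply: continuous_row => j.
  case: (split_ordP j) => k ->.
    apply: (@eq_continuous _ _ (fun z : S * T => cmap c z.1 0 k)).
      by move=> z; rewrite row_mxEl.
    apply: (@continuous_comp _ _ _ fst (fun x => cmap c x 0 k)); first exact: cvg_fst.
    apply: (@continuous_comp _ _ _ (cmap c) (fun v => v 0 k)); first exact: cc _ (mem_set cx).
    exact: coord_continuous.
  apply: (@eq_continuous _ _ (fun z : S * T => cmap d z.2 0 k)).
    by move=> z; rewrite row_mxEr.
  apply: (@continuous_comp _ _ _ snd (fun x => cmap d x 0 k)); first exact: cvg_snd.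
  apply: (@continuous_comp _ _ _ (cmap d) (fun v => v 0 k)); first exact: cd _ (mem_set dy).
  exact: coord_continuous.
- move=> w; rewrite inE => /im[iw1 iw2].
  apply: (@continuous_pair _ _ _ (fun w => cinv c (lsubmx w)) (fun w => cinv d (rsubmx w))).
    exact: (continuous_comp (@continuous_lsubmx _ _ _ _ w) (cic _ (mem_set iw1))).
  exact: (continuous_comp (@continuous_rsubmx _ _ _ _ w) (cid _ (mem_set iw2))).
Qed.

(** With a constant map in one slot, this freezes one variable of an action and yields the
    smoothness of [act g] and of orbit maps. *)
Lemma smooth_map_pair (R : realType) (M M1 M2 N : manifold R) (k1 : M -> M1) (k2 : M -> M2)
    (F : prod_space M1 M2 -> N) :
  smooth_map k1 -> smooth_map k2 -> smooth_map F -> smooth_map (fun y => F (k1 y, k2 y)).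
Proof.
move=> [ck1 sk1] [ck2 sk2] [cF sF].
have ck : continuous (fun y => (k1 y, k2 y) : prod_space M1 M2).
  by move=> y; apply: continuous_pair; [exact: ck1|exact: ck2].
have cG : continuous (fun y => F (k1 y, k2 y)).
  by move=> y; exact: (continuous_comp (ck y) (cF _)).
split=> // c d Mc Nd j; apply: Cinfty_near => _ [y [cy dy] <-].
have [c1 Mc1 c1y] := manifold_cover (k1 y); have [c2 Mc2 c2y] := manifold_cover (k2 y).
pose e := prod_chart c1 c2.
have Pe : atlas (prod_space M1 M2) e by exists c1, c2.
have Hc := manifold_chart Mc.
have He : is_chart e by apply: is_chart_prod; exact: manifold_chart.
pose D := (F @^-1` cdom d).
have oD : open D by apply: open_comp => [z _|]; [exact: cF|exact: open_cdom].
pose E := (fun y => (k1 y, k2 y) : prod_space M1 M2) @^-1` (cdom e `&` D).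
have oE : open E.
  apply: open_comp => [z _|]; first exact: ck.
  by apply: openI => //; have [] := He.
have im z : (cmap c @` (cdom c `&` E)) z ->
    [/\ cdom c (cinv c z), E (cinv c z) & cmap c (cinv c z) = z] by exact: chart_im_inv.
exists (cmap c @` (cdom c `&` E)); split; first by exists y.
have oi : open (cmap c @` (cdom c `&` E)) by exact: open_chart_im.
pose A z := cmap e (k1 (cinv c z), k2 (cinv c z)).
apply: (@Cinfty_eq _ _ _ ((fun w => cmap d (F (cinv e w)) 0 j) \o A)) => //.
  by move=> z /im[_ [[c1z c2z] _] _] /=; rewrite row_mxKl row_mxKr !cmapK.
apply: (@Cinfty_comp _ _ _ _ (cmap e @` (cdom e `&` D))) => //.
- exact: open_chart_im.
- by move=> z /im[_ Ez _]; exists (k1 (cinv c z), k2 (cinv c z)).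
- move=> l; case: (split_ordP l) => k ->; rewrite /A /=.
    under eq_fun do rewrite row_mxEl.
    by apply: Cinfty_sub (sk1 c c1 Mc Mc1 k) => _ [y' [cy' [[? ?] ?]] <-]; exists y'.
  under eq_fun do rewrite row_mxEr.
  by apply: Cinfty_sub (sk2 c c2 Mc Mc2 k) => _ [y' [cy' [[? ?] ?]] <-]; exists y'.
- exact: sF.
Qed.

Lemma smooth_map_cst (R : realType) (M N : manifold R) (y : N) : smooth_map (fun _ : M => y).
Proof.
split; first by move=> x; exact: cst_continuous.
by move=> c d _ _ j; exact: Cinfty_cst.
Qed.

Lemma bilinear_comb2 (R : realType) (V : lmodType R) (B : (V -> R) -> (V -> R) -> R)
    (a b : R) al be ga :
  bilinear_form B -> scalar al -> scalar be -> scalar ga ->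
  B ga (fun v => a * al v + b * be v) = a * B ga al + b * B ga be.
Proof.
move=> bB sal sbe sga.
have := (@bilinear_sum _ _ B 2 (fun i => if i == 0 then a else b)
  (fun i => if i == 0 then al else be) ga bB _ sga).2.
rewrite !big_ord_recl big_ord0 addr0 /= => <-; last by move=> i; case: ifP.
by congr (B ga); apply/funext => v; rewrite !big_ord_recl big_ord0 addr0.
Qed.

Lemma smooth_at_bracket (R : realType) (M : manifold R) (P : form2_field M) x f g :
  bivector_field P -> smooth_at x f -> smooth_at x g -> smooth_at x (bracket_of P f g).
Proof.
move=> [_ sP] sf sg; have [U [oU Ux sUf sUg]] := smooth_at2 sf sg.
by exists U; split; [exact: oU|exact: Ux|exact: sP].
Qed.

Lemma bracket_near (R : realType) (M : manifold R) (P : form2_field M) x f g h :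
  smooth_at x g -> (\forall y \near x, g y = h y) ->
  bracket_of P f g x = bracket_of P f h x.
Proof.
move=> sg gh; rewrite /bracket_of; congr (P x _ _); apply/funext => v.
exact: (tangent_near v sg gh).
Qed.

Lemma differential_push (R : realType) (M N : manifold R) (F : M -> N) x y f :
  smooth_map F -> F x = y -> smooth_at y f ->
  differential f (x := y) \o @push R M N F x y = differential (f \o F) (x := x).
Proof. by move=> sF Fx sf; apply/funext => v /=; exact: pushE. Qed.

Lemma lie_action_point (R : realType) (G : lie_group R) (M : manifold R) (act : G -> M -> M) g :
  lie_action act -> smooth_map (act g).
Proof.
move=> [_ _ sa].
exact: (smooth_map_pair (smooth_map_cst M g) (smooth_map_id M) sa).
Qed.

Lemma lie_action_orbit (R : realType) (G : lie_group R) (M : manifold R)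
    (act : G -> M -> M) x : lie_action act -> smooth_map (fun g => act g x).
Proof.
move=> [_ _ sa].
exact: (smooth_map_pair (smooth_map_id G) (smooth_map_cst G x) sa).
Qed.

(** The image of the unit is idempotent, and a group has only one idempotent. *)
Lemma lie_subgroup_one (R : realType) (G C : lie_group R) (iota : C -> G) :
  lie_subgroup iota -> iota (lone C) = lone G.
Proof.
move=> [_ im _ _]; have E : lmul (iota (lone C)) (iota (lone C)) = iota (lone C).
  by rewrite -im lmul1.
by rewrite -[LHS]lmul1 -(lmulV (iota (lone C))) -lmulA E.
Qed.

(** The pullback sends [xi] to minus the derivative along [xi] of [g |-> f (act g x)]. For [xi]
    tangent to [C] this differentiates a constant function on [C]. *)
Lemma annihilator_invariant (R : realType) (G C : lie_group R) (iota : C -> G)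
    (M : manifold R) (act : G -> M -> M) x f :
  lie_action act -> lie_subgroup iota -> smooth_at x f ->
  (forall c, f (act (iota c) x) = f x) ->
  annihilator (subalgebra iota)
    (differential f (x := x) \o (fun xi => infinitesimal_action act xi x)).
Proof.
move=> aact subC sf finv; have [act1 _ _] := aact.
have so := lie_action_orbit x aact.
have E (xi : lie_algebra G) : differential f (infinitesimal_action act xi x) =
    - xi (f \o (fun g => act g x)).
  by rewrite /differential /infinitesimal_action pushE.
have s1 : smooth_at (lone G) (f \o (fun g => act g x)).
  by apply: smooth_at_comp => //; rewrite act1.
split; first by move=> k u v /=; rewrite !E tangentE_add opprD -[RHS]/(k * _ + _) mulrN.
move=> _ [v _ <-] /=; rewrite E pushE//; [|by case: subC|exact: lie_subgroup_one].
rewrite (_ : _ \o iota = fun=> f x) ?tangent_cst ?oppr0//.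
by apply/funext => c /=; exact: finv.
Qed.

(** The assumptions concern only germs at [x] and the orbit of [x], so it applies both to global
    invariant functions and to pullbacks of local functions from the quotient. *)
Lemma jacobi_invariant (R : realType) (G C : lie_group R)
    (s : (lie_algebra G -> R) -> (lie_algebra G -> R) -> R) (iota : C -> G)
    (M : manifold R) (act : G -> M -> M) (P : form2_field M) x f g h :
  quasi_poisson s act P -> lie_subgroup iota -> reducing s iota ->
  smooth_at x f -> smooth_at x g -> smooth_at x h ->
  (forall c, f (act (iota c) x) = f x) -> (forall c, g (act (iota c) x) = g x) ->
  (forall c, h (act (iota c) x) = h x) ->
  bracket_of P f (bracket_of P g h) x + bracket_of P g (bracket_of P h f) x +
    bracket_of P h (bracket_of P f g) x = 0.
Proof.
move=> [aact bP _ PP] subC redC sf sg sh fi gi hi.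
have [n [X [Y dXY]]] := wedge_decomposition_exists x bP.
have := PP x n n X Y X Y dXY dXY _ _ _ (scalar_differential (x := x) f)
  (scalar_differential (x := x) g) (scalar_differential (x := x) h).
rewrite (schouten_jacobi dXY dXY sf sg sh) /trivector_action redC; last 3 first.
- exact: annihilator_invariant.
- exact: annihilator_invariant.
- exact: annihilator_invariant.
have n2 : (2 : R) != 0 by rewrite pnatr_eq0.
by move/(mulfI n2) => <-.
Qed.

(** The differential of an invariant function at [act (iota c) x], pulled back along [act (iota c)],
    is its differential at [x]; the invariance of [P] then compares the two brackets. *)
Lemma bracket_invariant (R : realType) (G C : lie_group R)
    (s : (lie_algebra G -> R) -> (lie_algebra G -> R) -> R) (iota : C -> G)
    (M : manifold R) (act : G -> M -> M) (P : form2_field M) f g :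
  quasi_poisson s act P ->
  invariant_functions iota act f -> invariant_functions iota act g ->
  invariant_functions iota act (bracket_of P f g).
Proof.
move=> [aact [_ sP] iP _] [sf fi] [sg gi]; split; first exact: (sP setT f g openT sf sg).
move=> c x; have sa := lie_action_point (iota c) aact.
have fE h : smooth_fun h -> (forall c x, h (act (iota c) x) = h x) ->
    differential h (x := act (iota c) x) \o
      @push R M M (act (iota c)) x (act (iota c) x) = differential h (x := x).
  move=> sh hi; rewrite differential_push//; last by exists setT; split=> //; exact: openT.
  by rewrite (_ : h \o act (iota c) = h)//; apply/funext => y /=.
by rewrite /bracket_of iP// fE// fE.
Qed.

Lemma invariant_poisson_bracket (R : realType) (G C : lie_group R)
    (s : (lie_algebra G -> R) -> (lie_algebra G -> R) -> R) (iota : C -> G)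
    (M : manifold R) (act : G -> M -> M) (P : form2_field M) :
  quasi_poisson s act P -> lie_subgroup iota -> reducing s iota ->
  poisson_bracket (invariant_functions iota act) (bracket_of P).
Proof.
move=> qP subC redC; have [_ [bP _] _ _] := qP.
have sat x f : invariant_functions iota act f -> smooth_at x f.
  by move=> [sf _]; exists setT; split; [exact: openT| |].
split.
- by move=> f g; exact: (bracket_invariant qP).
- by move=> f g _ _; apply/funext => x; exact: (bP x).2.
- move=> a f g h If Ig _; apply/funext => x.
  rewrite -(((bP x).1 a (differential f (x := x)) (differential g (x := x))
    (differential h (x := x))) _ _ _).1//.
  congr (P x); apply/funext => v; rewrite /differential.
  have sf := sat x _ If; have sg := sat x _ Ig; have sa := smooth_at_cst x a.
  rewrite (tangent_add v (smooth_atM sa sf) sg) (tangent_mul v sa sf).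
  by rewrite tangent_cst mul0r add0r.
- move=> f g h _ Ig Ih; apply/funext => x.
  rewrite /bracket_of [_ * h x]mulrC -(bilinear_comb2 _ _ (bP x).1)//.
  congr (P x); apply/funext => v; rewrite /differential.
  by rewrite (tangent_mul v (sat x _ Ig) (sat x _ Ih)) mulrC.
- move=> f g h If Ig Ih x.
  apply: (jacobi_invariant qP subC redC) => [|||c|c|c]; try exact: sat.
  + by case: If.
  + by case: Ig.
  + by case: Ih.
Qed.

(** * Descent to the orbit space *)

Lemma smooth_on_descend (R : realType) (M N : manifold R) (p : M -> N) (U : set N) h :
  surjective_submersion p -> open U -> smooth_on (p @^-1` U) (h \o p) -> smooth_on U h.
Proof.
move=> [sp onto sub] oU shp d Nd; apply: Cinfty_near => _ [y [dy Uy] <-].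
have [x px] := onto y; rewrite -{}px {y} in dy Uy *.
have [c Mc cx] := manifold_cover x; have Hc := manifold_chart Mc.
pose D := p @^-1` (U `&` cdom d).
have oD : open D.
  apply: open_comp => [z _|]; first exact: sp.1.
  by apply: openI => //; exact: open_cdom.
have oW := open_chart_im Hc oD.
(* Lifts of the coordinate vectors at [p x]. Their coordinates are the rows of the matrix [B] of
   [Cinfty_descend]; that they project to the coordinate vectors says that [B] times the Jacobian
   matrix is 1. *)
have [v vE] : exists v : 'I_(cdim d) -> tangent x,
    forall i, push p (p x) (v i) = coord_vec d i (p x).
  by exists (fun i => projT1 (cid (sub x (coord_vec d i (p x))))) => i; case: cid.
have sy j : smooth_at (p x) (fun y => cmap d y 0 j) by exact: smooth_at_coord.
have [||||V [oV Vx CV]] := @Cinfty_descend R _ _ (cmap c @` (cdom c `&` D))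
    (fun z => cmap d (p (cinv c z))) (fun w => h (cinv d w)) (cmap c x)
    (\matrix_(i, k) v i (fun y => cmap c y 0 k)) oW.
- by exists x.
- move=> j; apply: Cinfty_sub (sp.2 c d Mc Nd j).
  by move=> _ [z [cz [_ dz]] <-]; exists z.
- apply/matrixP => i j; rewrite !mxE.
  transitivity (v i ((fun y => cmap d y 0 j) \o p)).
    apply: etrans (esym (tangent_chart (v i) Mc cx (smooth_at_comp sp (sy j)))).
    by apply: eq_bigr => k _; rewrite !mxE.
  by rewrite -(pushE (v i) sp erefl (sy j)) vE (coord_vecE i Nd dy (sy j)) cder_coord// eq_sym.
- have CW : Cinfty (cmap c @` (cdom c `&` D)) (fun z => h (p (cinv c z))).
    apply: Cinfty_sub (shp c Mc).
    by move=> _ [z [cz [Uz _]] <-]; exists z.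
  apply: Cinfty_eq oW _ CW => z /(chart_im_inv Hc)[_ [_ dz] _] /=.
  by rewrite cmapK.
by exists V; split=> //; rewrite cmapK in Vx.
Qed.

(** Since [p \o act g] is [p], tangent vectors that correspond under [act g] have the same image.
    Keeping [y] and [x'] as variables with equations avoids transport between tangent spaces at
    equal points. *)
Lemma pushforward_invariant (R : realType) (G : lie_group R) (M N : manifold R)
    (act : G -> M -> M) (P : form2_field M) (p : M -> N) g x x' y
    (al be : tangent y -> R) :
  lie_action act -> invariant_form2 act P -> smooth_map p ->
  (forall z, p (act g z) = p z) -> p x = y -> x' = act g x -> scalar al -> scalar be ->
  P x' (al \o push p y) (be \o push p y) = P x (al \o push p y) (be \o push p y).
Proof.
move=> aact iP sp pg px -> sal sbe; have sa := lie_action_point g aact.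
have pgx : p (act g x) = y by rewrite pg.
rewrite iP; [|exact: scalar_push|exact: scalar_push].
have E (v : tangent x) : push p y (push (act g) (act g x) v) = push p y v :> tangent y.
  apply: tangent_ext => f sf; rewrite !pushE//; last first.
    by apply: smooth_at_comp; rewrite ?pgx.
  by congr (v _); apply/funext => z /=; rewrite pg.
by congr (P x _ _); apply/funext => v /=; rewrite E.
Qed.

Lemma quotient_poisson_structure (R : realType) (G C : lie_group R)
    (s : (lie_algebra G -> R) -> (lie_algebra G -> R) -> R) (iota : C -> G)
    (M N : manifold R) (act : G -> M -> M) (P : form2_field M) (p : M -> N) :
  quasi_poisson s act P -> lie_subgroup iota -> reducing s iota ->
  manifold_quotient iota act p ->
  exists Q : form2_field N, poisson_structure Q /\ descends p P Q.
Proof.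
move=> qP subC redC [subp orb]; have [aact [bP sP] iP _] := qP.
have [sp onto _] := subp.
have pinv c x : p (act (iota c) x) = p x by apply/esym/orb; exists c.
(* An arbitrary section, possibly discontinuous: the smoothness of [Q] comes from that of its
   brackets pulled back to [M]. *)
pose r y := projT1 (cid (onto y)).
have pr y : p (r y) = y by rewrite /r; case: cid.
pose Q : form2_field N := fun y al be => P (r y) (al \o push p y) (be \o push p y).
have dQ : descends p P Q.
  (* The chosen point over [p x] lies in the orbit of [x], where the pushforward gives the same
     value. *)
  move=> x al be sal sbe; have /orb[c rx] : p x = p (r (p x)) by rewrite pr.
  exact: (pushforward_invariant aact iP sp (pinv c) erefl rx sal sbe).
have spush y (al : tangent y -> R) : scalar al -> scalar (al \o @push R M N p (r y) y).
  by move=> sal; apply: scalar_push.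
have bQ y : bivector (Q y).
  split=> [a al be ga sal sbe sga|al be sal sbe].
    exact: (bP (r y)).1 a _ _ _ (spush y al sal) (spush y be sbe) (spush y ga sga).
  exact: (bP (r y)).2 _ _ (spush y al sal) (spush y be sbe).
have brQ x f g : smooth_at (p x) f -> smooth_at (p x) g ->
    bracket_of Q f g (p x) = bracket_of P (f \o p) (g \o p) x.
  by move=> sf sg; rewrite /bracket_of dQ// !differential_push.
have bfQ : bivector_field Q.
  split=> [|U f g oU sf sg]; first exact: bQ.
  apply: (smooth_on_descend subp oU).
  have oV : open (p @^-1` U) by apply: (open_comp _ oU) => x _; exact: sp.1.
  have := sP _ _ _ oV (smooth_on_comp sp oU sf) (smooth_on_comp sp oU sg).
  apply: (smooth_on_eq oV) => x Ux; apply/esym/brQ.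
    exact: smooth_on_at oU Ux sf.
  exact: smooth_on_at oU Ux sg.
exists Q; split; last exact: dQ.
split; first exact: bfQ.
move=> y m n X Y Z W dX dZ al be ga sal sbe sga.
have [f sf ->] := covector_differential sal.
have [g sg ->] := covector_differential sbe.
have [h sh ->] := covector_differential sga.
rewrite (schouten_jacobi dX dZ sf sg sh).
have [x px] := onto y; rewrite -{}px {y dX dZ al be ga sal sbe sga} in sf sg sh *.
(* The inner brackets on [N] and on [M] correspond only near [x], where the functions are smooth;
   the outer bracket depends only on germs. *)
have bb a b c : smooth_at (p x) a -> smooth_at (p x) b -> smooth_at (p x) c ->
    bracket_of Q a (bracket_of Q b c) (p x) =
    bracket_of P (a \o p) (bracket_of P (b \o p) (c \o p)) x.
  move=> sa sb sc; have sbc := smooth_at_bracket bfQ sb sc.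
  rewrite (brQ x a _ sa sbc); apply: bracket_near; first exact: smooth_at_comp sp sbc.
  have [U [oU Ux sUb sUc]] := smooth_at2 sb sc.
  have nU : \forall z \near x, U (p z).
    by apply: (sp.1 x); exact: open_nbhs_nbhs.
  apply: filterS nU => z Uz; apply: brQ.
    exact: smooth_on_at oU Uz sUb.
  exact: smooth_on_at oU Uz sUc.
rewrite (bb f g h sf sg sh) (bb g h f sg sh sf) (bb h f g sh sf sg).
have ci (a : N -> R) c : (a \o p) (act (iota c) x) = (a \o p) x by rewrite /= pinv.
rewrite (jacobi_invariant qP subC redC (smooth_at_comp sp sf) (smooth_at_comp sp sg)
  (smooth_at_comp sp sh) (ci f) (ci g) (ci h)).
by rewrite mulr0.
Qed.

Theorem theorem1 (R : realType) (G : lie_group R)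
  (s : (lie_algebra G -> R) -> (lie_algebra G -> R) -> R)
  (s_sym : symmetric2 s) (s_inv : Ad_invariant s)
  (M : manifold R) (act : G -> M -> M) (P : form2_field M)
  (qP : quasi_poisson s act P)
  (C : lie_group R) (iota : C -> G)
  (subC : lie_subgroup iota) (redC : reducing s iota) :
  poisson_bracket (invariant_functions iota act) (bracket_of P) /\
  forall (N : manifold R) (p : M -> N),
    manifold_quotient iota act p ->
    exists Q : form2_field N, poisson_structure Q /\ descends p P Q.
Proof.
split; first exact: invariant_poisson_bracket qP subC redC.
by move=> N p; exact: quotient_poisson_structure qP subC redC.
Qed.
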